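(* Let $p\in(1,\infty)$, $\alpha\in[0,1)$, $\theta:=(1-\alpha)p+\alpha$, $\kappa:=p/(\theta-1)$ and $\kappa^*:=\kappa/(\kappa-1)$. Let $\gamma\in\mathcal M^+_{\rm loc}(\mathbb R^d)$ with $\tilde m_{-\kappa}(\gamma)<\infty$. Then for all probability measures $\mu_0,\mu_1$ on $\mathbb R^d$, $$W_{\kappa^*,0;\gamma}(\mu_0,\mu_1)\le W_{p,\alpha;\gamma}(\mu_0,\mu_1).$$
   Context: Notation: $\mathcal M^+_{\rm loc}(\mathbb R^d)$ is the set of nonnegative Radon measures on $\mathbb R^d$ and $\mathcal M_{\rm loc}(\mathbb R^d;\mathbb R^d)$ the set of $\mathbb R^d$-valued Radon measures, both endowed with the weak$^*$ topology induced by duality with compactly supported continuous functions; $|\boldsymbol\nu|$ is the total variation measure of $\boldsymbol\nu$; $B_R$ is the open ball of radius $R$ centered at $0$. For an exponent $s\in(1,\infty)$ and $\beta\in[0,1]$, let $\theta_{s,\beta}:=(1-\beta)s+\beta$ and $\phi_{s,\beta}(\rho,w):=\rho^{\theta_{s,\beta}-s}|w|^s$ on $(0,\infty)\times\mathbb R^d$, extended to $\rho=0$ by $\phi_{s,\beta}(0,w):=\lim_{\rho\downarrow0}\phi_{s,\beta}(\rho,w)\in[0,\infty]$, with recession function $\phi^\infty_{s,\beta}(\rho,w):=\lim_{\lambda\to+\infty}\lambda^{-1}\phi_{s,\beta}(\lambda\rho,\lambda w)\in[0,\infty]$. Action functional: given $\gamma\in\mathcal M^+_{\rm loc}(\mathbb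 R^d)$, $\mu\in\mathcal M^+_{\rm loc}(\mathbb R^d)$, $\boldsymbol\nu\in\mathcal M_{\rm loc}(\mathbb R^d;\mathbb R^d)$ with $\mathrm{supp}\,\mu,\mathrm{supp}\,\boldsymbol\nu\subset\mathrm{supp}\,\gamma$, write the Lebesgue decompositions $\mu=\rho\gamma+\mu^\perp$, $\boldsymbol\nu=w\gamma+\boldsymbol\nu^\perp$, pick $\sigma$ with $\mu^\perp=\rho^\perp\sigma$, $\boldsymbol\nu^\perp=w^\perp\sigma$ and set $\Phi_{s,\beta}(\mu,\boldsymbol\nu|\gamma):=\int\phi_{s,\beta}(\rho,w)d\gamma+\int\phi_{s,\beta}^\infty(\rho^\perp,w^\perp)d\sigma$, and $+\infty$ if the support condition fails. $\mathrm{CE}(0,1;\mu_0\to\mu_1)$ is the set of pairs $(\mu,\boldsymbol\nu)$ with $(\mu_t)_{t\in[0,1]}$ weakly$^*$ continuous in $\mathcal M^+_{\rm loc}(\mathbb R^d)$, $\mu_{t=0}=\mu_0$, $\mu_{t=1}=\mu_1$, $(\boldsymbol\nu_t)_{t\in(0,1)}$ a Borel family in $\mathcal M_{\rm loc}(\mathbb R^d;\mathbb R^d)$ with $\int_0^1|\boldsymbol\nu_t|(B_R)dt<\infty$ for all $R$, and $\partial_t\mu_t+\nabla\cdot\boldsymbol\nu_t=0$ in the sense of distributions on $\mathbb R^d\times(0,1)$. Then $W_{s,\beta;\gamma}(\mu_0,\mu_1):=\big(\inf\{\int_0^1\Phi_{s,\beta}(\mu_t,\boldsymbol\nu_t|\gamma)dt:(\mu,\boldsymbol\nu)\in\mathrm{CE}(0,1;\mu_0\to\mu_1)\}\big)^{1/s}$.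 In particular for $\beta=0$, $\phi_{s,0}(\rho,w)=|w|^s$. For $\mu\in\mathcal M^+_{\rm loc}(\mathbb R^d)$ and $r\in\mathbb R$, $\tilde m_r(\mu):=\int(1\vee|x|)^r\,d\mu(x)$. *)

(* Defs.v *)
From HB Require Import structures.
From mathcomp Require Import all_boot all_order all_algebra.
From mathcomp Require Import all_classical all_reals all_analysis.
From mathcomp Require Import measurable_realfun lebesgue_integral.
Import Order.TTheory GRing.Theory Num.Theory.
Import numFieldNormedType.Exports.
Local Open Scope classical_set_scope.
Local Open Scope ring_scope.

Set Implicit Arguments.
Unset Strict Implicit.
Unset Printing Implicit Defensive.

Section Defs.
Context (R : realType) (d : nat).

Definition vec := 'rV[R]_d.

Definition Rd := g_sigma_algebraType (@open vec).

Definition dotv (u v : vec) : R := \sum_(i < d) u ord0 i * v ord0 i.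
Definition enorm (v : vec) : R := Num.sqrt (dotv v v).

Definition eball (x : vec) (r : R) : set Rd := [set y : Rd | enorm (y - x) < r].

Definition B (r : R) : set Rd := eball 0 r.

Definition bounded_set (A : set Rd) : Prop := exists r : R, A `<=` B r.

Definition locfin (m : set Rd -> \bar R) : Prop :=
  forall r : R, (m (B r) < +oo)%E.

Definition msupp (m : set Rd -> \bar R) : set Rd :=
  [set x : Rd | forall e : R, 0 < e -> (0 < m (eball x e))%E].

(* R^d-valued Radon measures: nu = w lam, with lam a nonnegative Radon *)
(* measure and w : R^d -> R^d Borel and locally lam-integrable.        *)
(* (Every R^d-valued Radon measure has this form, e.g. polar           *)
(*  decomposition lam = |nu|.)                                         *)

Definition vmeasurable (w : Rd -> vec) : Prop :=
  forall i : 'I_d, measurable_fun setT (fun x : Rd => w x ord0 i).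

Definition loc_integrable (m : {measure set Rd -> \bar R}) (w : Rd -> vec) : Prop :=
  forall r : R, (\int[m]_(x in B r) (enorm (w x))%:E < +oo)%E.

Definition is_vradon (lam : {measure set Rd -> \bar R}) (w : Rd -> vec) : Prop :=
  locfin lam /\ vmeasurable w /\ loc_integrable lam w.

Definition vmeas (lam : {measure set Rd -> \bar R}) (w : Rd -> vec)
  (A : set Rd) (i : 'I_d) : \bar R :=
  (\int[lam]_(x in A) (w x ord0 i)%:E)%E.

Definition vtotvar (lam : {measure set Rd -> \bar R}) (w : Rd -> vec)
  (A : set Rd) : \bar R :=
  (\int[lam]_(x in A) (enorm (w x))%:E)%E.

Definition theta (s b : R) : R := (1 - b) * s + b.

Definition phi_pos (s b : R) (rho : R) (w : vec) : R :=
  rho `^ (theta s b - s) * enorm w `^ s.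

(* extension to rho = 0 by the limit rho -> 0+ ; rho is a density,
   hence >= 0 *)
Definition phi (s b : R) (rho : R) (w : vec) : \bar R :=
  if 0 < rho then (phi_pos s b rho w)%:E
  else lim ((phi_pos s b r w)%:E @[r --> 0^'+]).

Definition phi_rec (s b : R) (rho : R) (w : vec) : \bar R :=
  lim (((l^-1)%:E * phi s b (l * rho) (l *: w))%E @[l --> +oo]).

Definition lebesgue_dec (gamma mu : {measure set Rd -> \bar R})
  (lam : {measure set Rd -> \bar R}) (nw : Rd -> vec)
  (rho : Rd -> R) (w : Rd -> vec) (sigma : {measure set Rd -> \bar R})
  (rhoP : Rd -> R) (wP : Rd -> vec) : Prop :=
  [/\ ((forall x, 0 <= rho x) /\ measurable_fun setT rho),
      ((forall x, 0 <= rhoP x) /\ measurable_fun setT rhoP),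
      (vmeasurable w /\ loc_integrable gamma w) /\
      (vmeasurable wP /\ loc_integrable sigma wP) /\
      (exists N : set Rd, measurable N /\ gamma N = 0%E /\ sigma (~` N) = 0%E),
      (forall A : set Rd, measurable A ->
         mu A = (\int[gamma]_(x in A) (rho x)%:E + \int[sigma]_(x in A) (rhoP x)%:E)%E) &
      (forall A : set Rd, measurable A -> bounded_set A -> forall i : 'I_d,
         vmeas lam nw A i = (vmeas gamma w A i + vmeas sigma wP A i)%E)].

Definition dec_value (s b : R) (gamma : {measure set Rd -> \bar R})
  (rho : Rd -> R) (w : Rd -> vec) (sigma : {measure set Rd -> \bar R})
  (rhoP : Rd -> R) (wP : Rd -> vec) : \bar R :=
  (\int[gamma]_x phi s b (rho x) (w x) + \int[sigma]_x phi_rec s b (rhoP x) (wP x))%E.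

(* Phi is independent of the choice of the decomposition (and of sigma);
   we take the infimum over all of them, which is therefore that common
   value.  +oo if the support condition fails.                           *)
Definition Phi (s b : R) (mu : {measure set Rd -> \bar R})
  (lam : {measure set Rd -> \bar R}) (nw : Rd -> vec)
  (gamma : {measure set Rd -> \bar R}) : \bar R :=
  if `[< msupp mu `<=` msupp gamma /\ msupp (vtotvar lam nw) `<=` msupp gamma >]
  then ereal_inf [set v : \bar R | exists rho w sigma rhoP wP,
          lebesgue_dec gamma mu lam nw rho w sigma rhoP wP /\
          v = dec_value s b gamma rho w sigma rhoP wP]
  else +oo%E.

Fixpoint Ck (V : normedModType R) (k : nat) (f : V -> R) : Prop :=
  match k with
  | 0 => continuous f
  | k.+1 => (forall x, differentiable f x) /\ (forall v : V, Ck k (fun x => 'D_v f x))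
  end.

Definition smooth (V : normedModType R) (f : V -> R) : Prop := forall k, Ck k f.

Definition Cc (f : vec -> R) : Prop :=
  continuous f /\ exists r : R, forall x, r < enorm x -> f x = 0.

Definition test_fun (f : vec * R -> R) : Prop :=
  smooth f /\ exists r a b : R, [/\ 0 < a, b < 1 &
     forall (x : vec) (t : R), r < enorm x \/ t < a \/ b < t -> f (x, t) = 0].

Definition dt_fun (f : vec * R -> R) (x : vec) (t : R) : R :=
  'D_1 (fun s : R => f (x, s)) t.
Definition grad_x (f : vec * R -> R) (x : vec) (t : R) : vec :=
  \row_(i < d) 'D_(delta_mx ord0 i : vec) (fun y : vec => f (y, t)) x.

Definition I01 : set R := `]0, 1[.
Definition I01c : set R := `[0, 1].

Definition leb := @lebesgue_measure R.

Definition integral_mu (m : {measure set Rd -> \bar R}) (f : vec -> R) : R :=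
  fine (\int[m]_x (f x)%:E)%E.

(* mu : [0,1] -> M+_loc, nu_t = (nw t) (lam t) for t in (0,1) *)
Definition CE (mu0 mu1 : {measure set Rd -> \bar R})
  (mu : R -> {measure set Rd -> \bar R})
  (lam : R -> {measure set Rd -> \bar R}) (nw : R -> Rd -> vec) : Prop :=
  [/\
      (forall t, I01c t -> locfin (mu t)) /\
      (forall f : vec -> R, Cc f ->
         {within I01c, continuous (fun t => integral_mu (mu t) f)}),
      ((forall A, measurable A -> mu 0 A = mu0 A) /\
       (forall A, measurable A -> mu 1 A = mu1 A)),
      (forall t, I01 t -> is_vradon (lam t) (nw t)) /\
      (forall A : set Rd, measurable A -> bounded_set A -> forall i : 'I_d,
         measurable_fun I01 (fun t : R => vmeas (lam t) (nw t) A i)),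
      (forall r : R,
         (\int[leb]_(t in I01) vtotvar (lam t) (nw t) (B r) < +oo)%E) &
      (forall f : vec * R -> R, test_fun f ->
         (\int[leb]_(t in I01) (\int[mu t]_x (dt_fun f x t)%:E)
          + \int[leb]_(t in I01)
               (\int[lam t]_x (dotv (grad_x f x t) (nw t x))%:E))%E = 0%E)].

Definition action (s b : R) (gamma : {measure set Rd -> \bar R})
  (mu : R -> {measure set Rd -> \bar R})
  (lam : R -> {measure set Rd -> \bar R}) (nw : R -> Rd -> vec) : \bar R :=
  (\int[leb]_(t in I01) Phi s b (mu t) (lam t) (nw t) gamma)%E.

Definition Wdist (s b : R) (gamma : {measure set Rd -> \bar R})
  (mu0 mu1 : {measure set Rd -> \bar R}) : \bar R :=
  ((ereal_inf [set a : \bar R | exists mu lam nw,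
      CE mu0 mu1 mu lam nw /\ a = action s b gamma mu lam nw]) `^ (s^-1))%E.

Definition mtilde (r : R) (m : {measure set Rd -> \bar R}) : \bar R :=
  (\int[m]_x ((Num.max 1 (enorm x)) `^ r)%:E)%E.

End Defs.

(* Main.v *)
Require Import Defs.
From HB Require Import structures.
From mathcomp Require Import all_boot all_order all_algebra.
From mathcomp Require Import all_classical all_reals all_analysis.
From mathcomp Require Import measurable_realfun lebesgue_integral.
From mathcomp Require Import ring lra.
Import Order.TTheory GRing.Theory Num.Theory.
Import numFieldNormedType.Exports.
Local Open Scope classical_set_scope.
Local Open Scope ring_scope.

(** The inequality is Young's inequality
    [|w|^(p q) <= q c^(q-1) rho^(theta-p) |w|^p + (1-q) c^q rho] with
    [q = 1/(1 + alpha (p-1))], so that [kappa* = p q], integrated in space and time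
    and optimised over [c]; the two recession functions coincide.  It needs
    [mu_t(R^d) <= 1] for every [t], which is where the moment of [gamma] enters:
    the mass [m_r(t)] of [mu_t] against a cutoff at scale [r] whose gradient is at
    most a constant times [r^-1 cutoff^b], [b = alpha (p-1)/p], varies by at most
    [C (l A + l max m_r + l^(1-kappa) r^-kappa gamma(B_r))] for every [l > 0],
    [A] being the action.  Then [r -> oo] and [l -> 0].

    Neither [Phi] nor the total variation of [nu_t] is assumed measurable in [t].
    The integral of a nonnegative non-measurable function is a lower integral, and
    the argument only uses inequalities that survive for lower integrals
    ([le_integral_affine], [le_integral_upper]). *)

(** * Smooth functions *)

(** Why the exponents fit: where [phi p alpha] has a finite value f, |w| = f^(1/p) rho^b, and 1/p +
    b + 1/kappa = 1. The factor cutoff^b in the gradient bound turns rho^b into (cutoff rho)^b, so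
    that the three-factor Young inequality produces the density of the cutoff mass itself. The
    leftover exponent 1/kappa falls on a constant that is integrated over B_r against gamma: this is
    where kappa and the moment come from.

    A profile built on exp(-1/s) admits such a gradient bound, because its derivative is controlled
    by every power below 1 of the profile, and b < 1.

    No bound on the mass is known beforehand, so the term C l max m_r has to be absorbed. The
    function m_r is continuous on [0,1], hence attains its maximum; it is at most 1 at both ends;
    elsewhere C l < 1 moves the term to the left side.

    In the final optimisation the Young bound q c^(q-1) A + (1-q) c^q equals A^q at c = A; values c
    > A are used so that A = 0 is covered. *)

Definition flat {R : realType} (n : nat) (s : R) : R :=
  if 0 < s then s^-1 ^+ n * expR (- s^-1) else 0.

Lemma flat_ge0 {R : realType} n (s : R) : 0 <= flat n s.
Proof.
rewrite /flat; case: ifPn => // s0.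
by rewrite mulr_ge0 ?expR_ge0// exprn_ge0// invr_ge0 ltW.
Qed.

(** The exponential series gives y^(n+1) <= (n+1)! e^y, read at y = 1/s. A bound linear in s is what
    makes the derivatives at 0 vanish. *)
Lemma flat_le {R : realType} n (s : R) : flat n s <= n.+1`!%:R * `|s|.
Proof.
rewrite /flat; case: ifPn => s0; last by rewrite mulr_ge0.
have y0 : 0 < s^-1 by rewrite invr_gt0.
rewrite gtr0_norm// expRN ler_pdivrMr ?expR_gt0//.
have := expR_ge1Dxn n (ltW y0).
have f0 : (0 : R) < n.+1`!%:R by rewrite ltr0n fact_gt0.
move=> h; have {}h : s^-1 ^+ n.+1 <= n.+1`!%:R * expR s^-1.
  rewrite -ler_pdivrMl// mulrC; apply: le_trans h; by rewrite lerDr.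
rewrite mulrAC -ler_pdivrMr//; by rewrite -exprSr.
Qed.

Lemma is_derive_flat {R : realType} n (s : R) :
  is_derive s 1 (flat n) (flat n.+2 s - n%:R * flat n.+1 s).
Proof.
have [s0|s0|->] := ltgtP s 0.
- have -> : flat n.+2 s - n%:R * flat n.+1 s = 0.
    by rewrite /flat (ltNge 0) (ltW s0)/=; ring.
  apply: (@near_eq_is_derive _ _ _ (cst 0)).
  near=> x; rewrite /flat /= ifF//.
  apply/negbTE; rewrite -leNgt ltW//.
  by near: x; apply: lt_nbhsl.
- rewrite /flat s0.
  pose g : R -> R := ((@GRing.inv R : R -> R) ^+ n) * (fun x : R => expR (- x^-1)).
  have sn0 : s != 0 by rewrite gt_eqF.
  apply: (@near_eq_is_derive _ _ _ g).
    near=> x; rewrite /g /flat exprfctE ifT//; by near: x; apply: lt_nbhsr.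
  have dV : is_derive s 1 (@GRing.inv R) (- s^-1 ^+ 2).
    apply: DeriveDef; first exact: derivableV.
    by rewrite (@deriveV _ _ (@id R))// derive_id exprVn /GRing.scale/= mulr1.
  have dE : is_derive s 1 (fun x : R => expR (- x^-1)) (expR (- s^-1) * s^-1 ^+ 2).
    apply: DeriveDef.
    - apply/derivable1_diffP; apply: (@differentiable_comp _ _ _ _ (fun x : R => - x^-1) expR).
      + apply: differentiableN; exact: differentiable_Rinv.
      + exact/derivable1_diffP/derivable_expR.
    - rewrite -derive1E (@derive1_comp _ (fun x : R => - x^-1) expR).
      + rewrite !derive1E; congr (_ * _); first by rewrite (congr1 (@^~ _) (@derive_expR R)).
        rewrite deriveN; last exact: derivableV.
        by rewrite derive_val opprK.
      + exact/derivableN/derivableV.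
      + exact: derivable_expR.
  apply: is_derive_eq; rewrite exprfctE /GRing.scale/=.
  clear g; case: n => [|n] /=; first by rewrite expr0; ring.
  by rewrite !exprS; ring.
- have -> : flat n.+2 0 - n%:R * flat n.+1 0 = 0 :> R.
    by rewrite /flat ltxx; ring.
  have F0 k : flat k 0 = 0 :> R by rewrite /flat ltxx.
  have H : (fun h : R => h^-1 *: (flat n (h *: 1 + 0) - flat n 0)) @ 0^' --> (0:R).
    apply/cvgrPdist_le => e e0.
    near=> h.
    rewrite sub0r normrN F0 subr0 addr0 /GRing.scale/= mulr1.
    (* The difference quotient at 0 is the next member of the family, to which [flat_le] applies. *)
    have -> : h^-1 * flat n h = flat n.+1 h.
      by rewrite /flat; case: ifPn => _; rewrite ?mulr0// exprS mulrA.
    rewrite ger0_norm ?flat_ge0//; apply: le_trans (flat_le _ _) _.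
    rewrite -ler_pdivlMl ?ltr0n ?fact_gt0//.
    near: h; apply: dnbhs0_le.
    by rewrite mulr_gt0// invr_gt0 ltr0n fact_gt0.
  apply: DeriveDef; [by apply/cvg_ex; exists 0|exact/cvg_lim].
Unshelve. all: by end_near. Qed.

Section chain.
Context {R : realType} {V : normedModType R}.

Lemma derive_chain (h : R -> R) (f : V -> R) x v (dh : R) :
  differentiable f x -> is_derive (f x) 1 h dh ->
  differentiable (h \o f) x /\ 'D_v (h \o f) x = dh * 'D_v f x.
Proof.
move=> df dh1; have hd : differentiable h (f x).
  by apply/derivable1_diffP; case: dh1.
split; first exact: differentiable_comp.
rewrite deriveE; last exact: differentiable_comp.
rewrite diff_comp//= deriveE//.
have hd1 : derivable h (f x) 1 by case: dh1.
by rewrite deriv1E// derive1E derive_val /GRing.scale/= mulrC.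
Qed.

(* Closed under directional derivatives, since the derivative of [flat n] is
   [flat n.+2 - n * flat n.+1]; hence every member is smooth. *)
Inductive elementary : (V -> R) -> Prop :=
| el_affine f : (forall x, differentiable f x) ->
    (forall v, exists c, 'D_v f = cst c) -> elementary f
| el_add f g : elementary f -> elementary g -> elementary (fun x => f x + g x)
| el_mul f g : elementary f -> elementary g -> elementary (fun x => f x * g x)
| el_flat n f : elementary f -> elementary (flat n \o f)
| el_inv f : (forall x, f x != 0) -> elementary f -> elementary (fun x => (f x)^-1).

Lemma el_cst c : elementary (cst c).
Proof.
apply: el_affine => [x|v]; first exact: differentiable_cst.
by exists 0; apply/funext => x; rewrite derive_cst.
Qed.

Lemma elementary_derive f : elementary f ->
  (forall x, differentiable f x) /\ (forall v, elementary ('D_v f)).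
Proof.
elim=> {f} [f df dc|f g ef [df Df] eg [dg Dg]|f g ef [df Df] eg [dg Dg]|n f ef [df Df]|f f0 ef [df Df]].
- by split => // v; have [c ->] := dc v; exact: el_cst.
- split => [x|v]; first exact: differentiableD.
  rewrite (_ : 'D_v _ = fun x => 'D_v f x + 'D_v g x); first exact: el_add.
  by apply/funext => x; rewrite deriveD//; exact: diff_derivable.
- split => [x|v]; first exact: differentiableM.
  rewrite (_ : 'D_v _ = fun x => f x * 'D_v g x + g x * 'D_v f x).
    by apply: el_add; exact: el_mul.
  by apply/funext => x; rewrite deriveM//; exact: diff_derivable.
- split => [x|v].
    by have [] := derive_chain _ _ _ 0 _ (df x) (is_derive_flat n (f x)).
  rewrite (_ : 'D_v _ = fun x => ((flat n.+2 \o f) x + (- n%:R) * (flat n.+1 \o f) x) * 'D_v f x).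
    apply: el_mul => //; apply: el_add; first exact: el_flat.
    by apply: el_mul; [exact: el_cst|exact: el_flat].
  apply/funext => x.
  by have [_ ->] := derive_chain _ _ _ v _ (df x) (is_derive_flat n (f x)); rewrite mulNr.
- split => [x|v]; first exact: differentiableV.
  rewrite (_ : 'D_v _ = fun x => (-1 * ((f x)^-1 * (f x)^-1)) * 'D_v f x).
    do 2 (apply: el_mul => //); first exact: el_cst.
    by apply: el_mul; exact: el_inv.
  apply/funext => x; rewrite deriveV//; last exact: diff_derivable.
  by rewrite /GRing.scale/= mulN1r -exprVn expr2.
Qed.

Lemma elementary_smooth f : elementary f -> smooth f.
Proof.
move=> ef k; elim: k f ef => [|k IH] f ef /=.
  by move=> x; apply: differentiable_continuous; case: (elementary_derive _ ef).
by have [df Df] := elementary_derive _ ef; split => // v; exact: IH.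
Qed.

End chain.

Section linear_functional.
Context {R : realType} {V : normedModType R}.

Lemma linear_functional_derive (f : V -> R) :
  (forall a x y, f (a *: x + y) = a * f x + f y) -> continuous f ->
  forall x, differentiable f x /\ forall v, 'D_v f x = f v.
Proof.
move=> lf cf x.
have lf' : scalable_for (GRing.mul : R -> R -> R) f.
  move=> a y; have := lf a y 0; rewrite addr0 => ->.
  by have := lf 1 0 0; rewrite scale1r addr0 mul1r => /eqP; rewrite -subr_eq subrr => /eqP <-; rewrite addr0.
have lf'' : {morph f : x y / x + y >-> x + y}.
  by move=> y z; have := lf 1 y z; rewrite scale1r mul1r.
(* Bundling [f] as a linear map gives access to the fact that a continuous linear map is its own
   differential. *)
have @L : {linear V -> R}.
  exists f; do 2![eexists]; do ?[constructor] => //.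
  by have := lf 1 0 0; rewrite scale1r addr0 mul1r => /eqP; rewrite -subr_eq subrr => /eqP.
have cL : continuous L by [].
have dL : differentiable L x by exact/linear_differentiable.
split; first exact: dL.
move=> v; rewrite deriveE; last exact: dL.
by rewrite -[f]/(L : V -> R) diff_lin.
Qed.

Lemma el_linear (f : V -> R) :
  (forall a x y, f (a *: x + y) = a * f x + f y) -> continuous f -> elementary f.
Proof.
move=> lf cf; apply: el_affine => [x|v].
  by have [] := linear_functional_derive f lf cf x.
exists (f v); apply/funext => x.
by have [_ ->] := linear_functional_derive f lf cf x.
Qed.

Lemma el_sum n (F : 'I_n -> V -> R) : (forall i, elementary (F i)) ->
  elementary (fun x => \sum_(i < n) F i x).
Proof.
elim: n F => [|n IH] F eF.
  by under eq_fun do rewrite big_ord0; exact: el_cst.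
under eq_fun do rewrite big_ord_recr /=.
by apply: el_add => //; exact: IH.
Qed.

End linear_functional.

(** * A smooth step from 0 to 1 *)

Section ramp.
Context {R : realType}.
Implicit Types s : R.

Lemma flat_gt0 n s : 0 < s -> 0 < flat n s.
Proof.
move=> s0; rewrite /flat s0 mulr_gt0 ?expR_gt0// exprn_gt0//.
by rewrite invr_gt0.
Qed.

Lemma flat_eq0 n s : s <= 0 -> flat n s = 0.
Proof. by move=> s0; rewrite /flat ltNge s0. Qed.

(** The denominator never vanishes, since s and 1 - s are not both nonpositive. *)
Definition ramp s : R := flat 0 s * (flat 0 s + flat 0 (1 - s))^-1.

(** The derivative of [ramp] after the products [flat 0 s * flat 2 s] have cancelled in the quotient
    rule; in this form it is visibly nonnegative. *)
Definition ramp' s : R := (flat 2 s * flat 0 (1 - s) + flat 0 s * flat 2 (1 - s))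
   * ((flat 0 s + flat 0 (1 - s))^-1 ^+ 2).

Lemma ramp_den s : 0 < flat 0 s + flat 0 (1 - s).
Proof.
have [s0|s0] := ltP 0 s.
  by rewrite ltr_pwDl ?flat_gt0// flat_ge0.
by rewrite ltr_wpDl ?flat_ge0// flat_gt0//; lra.
Qed.

Lemma ramp_ge0 s : 0 <= ramp s.
Proof. by rewrite mulr_ge0 ?flat_ge0// invr_ge0 ltW// ramp_den. Qed.

Lemma ramp_le1 s : ramp s <= 1.
Proof. by rewrite ler_pdivrMr ?ramp_den// mul1r lerDl flat_ge0. Qed.

Lemma ramp_eq0 s : s <= 0 -> ramp s = 0.
Proof. by move=> s0; rewrite /ramp flat_eq0// mul0r. Qed.

Lemma ramp_eq1 s : 1 <= s -> ramp s = 1.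
Proof.
move=> s0; rewrite /ramp (flat_eq0 0 (1 - s)) ?addr0 ?mulfV//; last by rewrite subr_le0.
by rewrite gt_eqF// flat_gt0//; lra.
Qed.

Lemma ramp'_ge0 s : 0 <= ramp' s.
Proof.
rewrite mulr_ge0// ?exprn_ge0// ?invr_ge0 ?(ltW (ramp_den _))//.
by rewrite addr_ge0// mulr_ge0// flat_ge0.
Qed.

Lemma ramp'_eq0 s : s <= 0 \/ 1 <= s -> ramp' s = 0.
Proof.
move=> [s0|s0]; rewrite /ramp'.
  by rewrite !(flat_eq0 _ s)// !mul0r addr0 mul0r.
by rewrite !(flat_eq0 _ (1 - s)) ?subr_le0// !mulr0 addr0 mul0r.
Qed.

Lemma is_derive_ramp s : is_derive s 1 ramp (ramp' s).
Proof.
have d1 := is_derive_flat 0 s.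
have d2 : is_derive s 1 (fun s => flat 0 (1 - s)) (- flat 2 (1 - s)).
  have dl : is_derive s (1:R) (fun s : R => 1 - s) (-1).
    by apply: is_derive_eq; ring.
  have df : differentiable (fun s : R => 1 - s) s.
    by apply/derivable1_diffP; case: dl.
  have [h1 h2] := derive_chain (flat 0) (fun s : R => 1 - s) s 1 _ df (is_derive_flat 0 (1 - s)).
  apply: DeriveDef; first exact/derivable1_diffP.
  by rewrite h2 derive_val mul0r subr0 mulrN1.
have dd : is_derive s 1 (fun s => flat 0 s + flat 0 (1 - s)) (flat 2 s - flat 2 (1 - s)).
  by apply: is_derive_eq; rewrite mul0r subr0.
have den0 : flat 0 s + flat 0 (1 - s) != 0 by rewrite gt_eqF ?ramp_den.
have di : is_derive s 1 (fun s => (flat 0 s + flat 0 (1 - s))^-1)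
   (- (flat 0 s + flat 0 (1 - s)) ^- 2 * (flat 2 s - flat 2 (1 - s))).
  have [dd1 dd2] := dd.
  apply: DeriveDef; first exact: derivableV.
  by rewrite deriveV// dd2.
apply: is_derive_eq.
rewrite /GRing.scale/= /ramp' mul0r subr0 -exprVn.
have: (flat 0 s + flat 0 (1 - s)) * (flat 0 s + flat 0 (1 - s))^-1 = 1 by rewrite mulfV.
move: (flat 0 s) (flat 0 (1 - s)) (flat 2 s) (flat 2 (1 - s)) (_^-1) => a b c e i ab.
(* A factor (a + b) * i = 1 is inserted so that both sides carry i^2 and the identity becomes
   polynomial. *)
rewrite (_ : i * c = ((a + b) * i) * i * c); last by rewrite ab mul1r.
ring.
Qed.

Lemma el_ramp {V : normedModType R} (f : V -> R) : elementary f -> elementary (ramp \o f).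
Proof.
move=> ef.
have e1 : elementary (fun x => 1 + -1 * f x).
  by apply: el_add; [exact: el_cst|apply: el_mul => //; exact: el_cst].
rewrite (_ : _ \o _ = fun x => (flat 0 \o f) x *
   ((flat 0 \o f) x + (flat 0 \o (fun x => 1 + -1 * f x)) x)^-1).
  apply: el_mul; first exact: el_flat.
  apply: el_inv => [x|].
    by rewrite /= mulN1r gt_eqF ?ramp_den.
  by apply: el_add; exact: el_flat.
by apply/funext => x /=; rewrite /ramp mulN1r.
Qed.

Lemma continuous_flat n : continuous (flat n : R -> R).
Proof.
move=> s; apply: differentiable_continuous; apply/derivable1_diffP.
by case: (is_derive_flat n s).
Qed.

Lemma continuous_ramp' : continuous ramp'.
Proof.
have f1 n : continuous (fun s : R => flat n (1 - s)).
  move=> s; apply: (@continuous_comp _ _ _ (fun s : R => 1 - s) (flat n)).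
    by apply: continuousB; [exact: cst_continuous|exact: cvg_id].
  exact: continuous_flat.
move=> s; rewrite /continuous_at /ramp'; under eq_fun do rewrite expr2.
have cV : (flat 0 x + flat 0 (1 - x))^-1 @[x --> s] --> (flat 0 s + flat 0 (1 - s))^-1.
  apply: cvgV; first by rewrite gt_eqF ?ramp_den.
  by apply: cvgD; [exact: continuous_flat|exact: f1].
rewrite expr2; apply: cvgM; last exact: cvgM.
by apply: cvgD; apply: cvgM; (exact: continuous_flat || exact: f1).
Qed.

Lemma is_derive_ramp_affine (a b s : R) :
  is_derive s 1 (fun t => ramp ((t - a) * b)) (ramp' ((s - a) * b) * b).
Proof.
have dl : is_derive s (1:R) (fun t : R => (t - a) * b) b.
  by apply: is_derive_eq; rewrite subr0 scaler0 add0r /GRing.scale/= mulr1.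
have df : differentiable (fun t : R => (t - a) * b) s.
  by apply/derivable1_diffP; case: dl.
have [h1 h2] := derive_chain ramp (fun t : R => (t - a) * b) s 1 _ df (is_derive_ramp _).
apply: DeriveDef; first exact/derivable1_diffP.
by rewrite h2 derive_val.
Qed.

End ramp.

(** * Cutoffs and test functions *)

Section euclidean.
Context {R : realType} {d : nat}.
Implicit Types (x y : vec R d).

Lemma dotvv_ge0 x : 0 <= dotv x x.
Proof. by apply: sumr_ge0 => i _; rewrite -expr2 sqr_ge0. Qed.

Lemma enorm_ge0 x : 0 <= enorm x.
Proof. exact: sqrtr_ge0. Qed.

Lemma enorm_sqr x : enorm x ^+ 2 = dotv x x.
Proof. by rewrite sqr_sqrtr// dotvv_ge0. Qed.

Lemma normr_coord_enorm x i : `|x ord0 i| <= enorm x.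
Proof.
rewrite -sqrtr_sqr; apply: ler_wsqrtr; rewrite /dotv (bigD1 i)//= expr2 lerDl.
by apply: sumr_ge0 => j _; rewrite -expr2 sqr_ge0.
Qed.

Lemma enormZ (l : R) x : 0 <= l -> enorm (l *: x) = l * enorm x.
Proof.
move=> l0; rewrite /enorm (_ : dotv (l *: x) (l *: x) = l ^+ 2 * dotv x x).
  by rewrite sqrtrM ?sqr_ge0// sqrtr_sqr ger0_norm.
rewrite /dotv mulr_sumr; apply: eq_bigr => i _; rewrite !mxE; ring.
Qed.

Lemma coord_linear i (a : R) x y :
  (a *: x + y) ord0 i = a * x ord0 i + y ord0 i.
Proof. by rewrite !mxE. Qed.

Lemma continuous_coord i : continuous (fun x : vec R d => x ord0 i).
Proof. exact: coord_continuous. Qed.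

Lemma el_dotvv {V : normedModType R} (f : V -> vec R d) :
  (forall i, elementary (fun p => f p ord0 i)) -> elementary (fun p => dotv (f p) (f p)).
Proof. by move=> ef; apply: el_sum => i; exact: el_mul. Qed.

Lemma el_dotv : elementary (fun x : vec R d => dotv x x).
Proof.
apply: (el_dotvv id) => i.
by apply: el_linear; [exact: coord_linear|exact: continuous_coord].
Qed.

Lemma differentiable_dotv x : differentiable (fun y : vec R d => dotv y y) x.
Proof. exact: (elementary_derive _ el_dotv).1. Qed.

Lemma derive_dotv x i :
  'D_(delta_mx ord0 i : vec R d) (fun y : vec R d => dotv y y) x = 2 * x ord0 i.
Proof.
have H j := linear_functional_derive _ (coord_linear j) (continuous_coord j) x.
have dj j : derivable (fun y : vec R d => y ord0 j) x (delta_mx ord0 i).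
  exact/diff_derivable/(H j).1.
rewrite (_ : (fun y => _) =
    \sum_(j < d) ((fun y : vec R d => y ord0 j) * (fun y : vec R d => y ord0 j))); last first.
  by apply/funext => y; rewrite fct_sumE.
rewrite derive_sum; last by move=> j; exact: derivableM.
rewrite (bigD1 i)//= big1 => [|j ji]; last first.
  rewrite deriveM// (H j).2 !mxE/= (negbTE ji) /GRing.scale/= mulr0 addr0//.
by rewrite deriveM// (H i).2 !mxE/= eqxx /GRing.scale/= mulr1 addr0 mulr_natl mulr2n.
Qed.

Lemma continuous_dotv : continuous (fun y : vec R d => dotv y y).
Proof. by move=> x; apply: differentiable_continuous; exact: differentiable_dotv. Qed.

Lemma continuous_enorm : continuous (@enorm R d).
Proof.
move=> x; apply: (@continuous_comp _ _ _ (fun y : vec R d => dotv y y) Num.sqrt).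
  exact: continuous_dotv.
exact: sqrt_continuous.
Qed.

End euclidean.

Section flat_bounds.
Context {R : realType}.
Implicit Types s : R.

Lemma flat0E s : 0 < s -> flat 0 s = expR (- s^-1).
Proof. by move=> s0; rewrite /flat s0 expr0 mul1r. Qed.

Lemma le_flat0 s t : s <= t -> flat 0 s <= flat 0 t.
Proof.
move=> st; have [s0|s0] := ltP 0 s; last by rewrite (flat_eq0 _ _ s0) flat_ge0.
have t0 := lt_le_trans s0 st.
by rewrite !flat0E// ler_expR lerN2 lef_pV2.
Qed.

(** With y = 1/s the claim is y^2 <= 4/(1-b)^2 e^((1-b)y), the square of u <= e^u at u = (1-b)y/2.
    As [flat 2] is the derivative of [flat 0], this bounds the derivative by a power of the
    function. *)
Lemma flat2_le b s : b < 1 ->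
  flat 2 s <= 4 / (1 - b) ^+ 2 * flat 0 s `^ b.
Proof.
move=> b1; have b0 : 0 < 1 - b by rewrite subr_gt0.
have [s0|s0] := ltP 0 s; last first.
  by rewrite flat_eq0// mulr_ge0 ?powR_ge0// divr_ge0// exprn_ge0// ltW.
rewrite flat0E// -expRM {1}/flat s0.
set y := s^-1; have y0 : 0 < y by rewrite invr_gt0.
have -> : expR (- y) = expR (- ((1 - b) * y)) * expR (- y * b).
  by rewrite -expRD; congr expR; ring.
rewrite mulrA ler_wpM2r ?expR_ge0// expRN ler_pdivrMr ?expR_gt0//.
rewrite mulrAC ler_pdivlMr ?exprn_gt0//.
have h : 0 <= (1 - b) * y / 2 by rewrite divr_ge0// mulr_ge0// ltW.
have -> : (1 - b) * y = 2%:R * ((1 - b) * y / 2) by field.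
rewrite expRM_natl -exprMn.
rewrite (_ : y * (1 - b) = 2 * ((1 - b) * y / 2)); last by field.
rewrite exprMn (_ : 2 ^+ 2 = 4); last by ring.
rewrite ler_pM2l//; apply: lerXn2r; rewrite ?nnegrE ?expR_ge0//.
by apply: le_trans (expR_ge1Dx _); rewrite lerDr.
Qed.

End flat_bounds.

Section cutoff.
Context {R : realType} {d : nat}.
Implicit Types (x : vec R d) (r : R).

(** The factor e normalises the value at the origin to 1, so that the cutoffs increase to 1 as r
    grows. A profile with exp(-1/s) decay at the sphere |x| = r is chosen for the sake of
    [flat2_le]. *)
Definition cutoff r x : R := expR 1 * flat 0 (1 - dotv x x / r ^+ 2).

Lemma cutoff_ge0 r x : 0 <= cutoff r x.
Proof. by rewrite mulr_ge0 ?expR_ge0// flat_ge0. Qed.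

Lemma flat0_1 : expR 1 * flat 0 (1 : R) = 1.
Proof. by rewrite flat0E// invr1 expRxMexpNx_1. Qed.

Lemma cutoff_le1 r x : cutoff r x <= 1.
Proof.
rewrite -flat0_1 ler_pM2l ?expR_gt0//; apply: le_flat0.
by rewrite gerBl divr_ge0 ?dotvv_ge0// sqr_ge0.
Qed.

Lemma cutoff_eq0 r x : 0 < r -> r <= enorm x -> cutoff r x = 0.
Proof.
move=> r0 rx; rewrite /cutoff flat_eq0 ?mulr0//.
rewrite subr_le0 ler_pdivlMr ?exprn_gt0// mul1r -enorm_sqr.
by apply: lerXn2r; rewrite // nnegrE ?enorm_ge0// ltW.
Qed.

Lemma le_cutoff r s x : 0 < r -> r <= s -> cutoff r x <= cutoff s x.
Proof.
move=> r0 rs; rewrite ler_pM2l ?expR_gt0//; apply: le_flat0.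
rewrite lerD2l lerN2 ler_wpM2l ?dotvv_ge0//.
have s0 := lt_le_trans r0 rs.
by rewrite lef_pV2 ?posrE ?exprn_gt0//; apply: lerXn2r; rewrite // nnegrE ltW.
Qed.

Lemma cvg_cutoff x : cutoff n.+1%:R x @[n --> \oo] --> (1 : R).
Proof.
rewrite -[X in _ --> X]flat0_1; apply: cvgM; first exact: cvg_cst.
apply: continuous_cvg; first exact: continuous_flat.
rewrite -[X in _ --> X]subr0; apply: cvgB; first exact: cvg_cst.
rewrite -(mulr0 (dotv x x)); apply: cvgM; first exact: cvg_cst.
rewrite -(mulr0 0); under eq_fun do rewrite expr2 invfM.
have h : (n.+1%:R^-1 : R) @[n --> \oo] --> (0 : R) by exact: cvg_harmonic.
by apply: cvgM; exact: h.
Qed.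

Lemma cutoff_elementary {V : normedModType R} (f : V -> vec R d) r :
  (forall i, elementary (fun p => f p ord0 i)) ->
  elementary (fun p => cutoff r (f p)).
Proof.
move=> ef; apply: el_mul; first exact: el_cst.
apply: (el_flat 0 (fun p => 1 - dotv (f p) (f p) / r ^+ 2)).
rewrite (_ : (fun _ => _) = (fun p => 1 + dotv (f p) (f p) * (- r ^- 2))); last first.
  by apply/funext => p; rewrite mulrN.
by apply: el_add; [exact: el_cst|apply: el_mul; [exact: el_dotvv|exact: el_cst]].
Qed.

Lemma continuous_cutoff r : continuous (cutoff r).
Proof.
move=> x; apply: differentiable_continuous.
apply: (elementary_derive _ (cutoff_elementary id r _)).1 => i.
by apply: el_linear; [exact: coord_linear|exact: continuous_coord].
Qed.

Definition dcutoff r i x : R :=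
  expR 1 * (flat 2 (1 - dotv x x / r ^+ 2) * (- r ^- 2 * (2 * x ord0 i))).

Lemma differentiable_cutoff r x : differentiable (cutoff r) x.
Proof.
apply: (elementary_derive _ (cutoff_elementary id r _)).1 => i.
by apply: el_linear; [exact: coord_linear|exact: continuous_coord].
Qed.

Lemma derive_cutoff r x i :
  'D_(delta_mx ord0 i : vec R d) (cutoff r) x = dcutoff r i x.
Proof.
have dd := differentiable_dotv x.
pose u := fun y : vec R d => 1 + (- r ^- 2) * dotv y y.
have du1 : differentiable (fun y : vec R d => (- r ^- 2) * dotv y y) x.
  by apply: differentiableM => //; exact: differentiable_cst.
have du : differentiable u x by apply: differentiableD => //; exact: differentiable_cst.
have Du : 'D_(delta_mx ord0 i : vec R d) u x = - r ^- 2 * (2 * x ord0 i).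
  rewrite /u deriveD; [|exact: derivable_cst|exact: diff_derivable].
  rewrite derive_cst add0r deriveM; [|exact: derivable_cst|exact: diff_derivable].
  by rewrite derive_cst scaler0 addr0 derive_dotv.
have [h1 h2] := derive_chain (flat 0) u x (delta_mx ord0 i) _ du (is_derive_flat 0 (u x)).
have -> : cutoff r = (fun y => expR 1 * (flat 0 \o u) y).
  by apply/funext => y; rewrite /cutoff /u/= mulNr (mulrC (r ^- 2)).
rewrite deriveM; [|exact: derivable_cst|exact: diff_derivable].
rewrite derive_cst scaler0 addr0 /GRing.scale/= h2 Du mul0r subr0.
by rewrite /dcutoff /u mulNr (mulrC (r ^- 2) (dotv _ _)).
Qed.

Lemma dcutoff_eq0 r i x : 0 < r -> r <= enorm x -> dcutoff r i x = 0.
Proof.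
move=> r0 rx; rewrite /dcutoff flat_eq0 ?mul0r ?mulr0//.
rewrite subr_le0 ler_pdivlMr ?exprn_gt0// mul1r -enorm_sqr.
by apply: lerXn2r; rewrite // nnegrE ?enorm_ge0// ltW.
Qed.

(** The 8 is 4 * 2: the 4 comes from [flat2_le], and the inner derivative 2 |x_i| / r^2 is at most 2
    / r inside the ball. Passing from [flat 0] to [cutoff] uses e >= 1 and b >= 0. *)
Lemma dcutoff_le r b i x : 0 < r -> 0 <= b -> b < 1 ->
  `|dcutoff r i x| <= expR 1 * 8 / (1 - b) ^+ 2 * (r^-1 * cutoff r x `^ b).
Proof.
move=> r0 b0 b1.
have [rx|xr] := leP r (enorm x).
  rewrite dcutoff_eq0// normr0 !mulr_ge0 ?expR_ge0 ?powR_ge0 ?invr_ge0 ?sqr_ge0//.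
  exact: ltW.
rewrite /dcutoff normrM (ger0_norm (expR_ge0 _)) -!mulrA ler_pM2l ?expR_gt0//.
rewrite normrM (ger0_norm (flat_ge0 _ _)).
have h1 : `|(- r ^- 2 * (2 * x ord0 i))| <= 2 * r^-1.
  rewrite normrM normrN normrM (@ger0_norm _ (2:R))// (@ger0_norm _ (r ^- 2)); last first.
    by rewrite invr_ge0 sqr_ge0.
  rewrite mulrCA ler_pM2l// expr2 invfM -mulrA ger_pMr ?invr_gt0//.
  rewrite ler_pdivrMl// mulr1; apply: le_trans (ltW xr); exact: normr_coord_enorm.
apply: le_trans (ler_wpM2l (flat_ge0 _ _) h1) _.
have h2 := flat2_le b (1 - dotv x x / r ^+ 2) b1.
apply: le_trans (ler_wpM2r _ h2) _; first by rewrite mulr_ge0// invr_ge0 ltW.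
have h3 : flat 0 (1 - dotv x x / r ^+ 2) `^ b <= cutoff r x `^ b.
  apply: ge0_ler_powR => //; rewrite ?nnegrE ?flat_ge0 ?cutoff_ge0//.
  rewrite /cutoff ler_peMl ?flat_ge0//; apply: le_trans (expR_ge1Dx _); by rewrite lerDl.
rewrite (_ : _ * (2 / r) = (8 * ((1 - b) ^- 2 * r^-1)) * flat 0 (1 - dotv x x / r ^+ 2) `^ b); last by ring.
rewrite -!mulrA ler_pM2l// ler_pM2l ?invr_gt0 ?exprn_gt0 ?subr_gt0//.
by rewrite ler_pM2l ?invr_gt0.
Qed.

Lemma continuous_dcutoff r i : continuous (dcutoff r i).
Proof.
have e : elementary (cutoff r).
  apply: (cutoff_elementary id r) => j.
  by apply: el_linear; [exact: coord_linear|exact: continuous_coord].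
have [_ /(_ (delta_mx ord0 i)) D] := elementary_derive _ e.
rewrite (_ : dcutoff r i = 'D_(delta_mx ord0 i : vec R d) (cutoff r)).
  by move=> x; apply: differentiable_continuous; exact: (elementary_derive _ D).1.
by apply/funext => x; rewrite derive_cutoff.
Qed.

End cutoff.

(** * Test functions in space and time *)

Section test_function.
Context {R : realType} {d : nat}.
Implicit Types (t a b k : R).

(** Rises from 0 to 1 on [a, a + 1/k] and falls back on [b, b + 1/k]. *)
Definition bump a b k t : R := ramp ((t - a) * k) - ramp ((t - b) * k).

Definition space_time_bump r a b k (p : vec R d * R) : R :=
  cutoff r p.1 * bump a b k p.2.

(** At every time one of the two ramps is constant: up to b the second is 0, and after b the first
    has already reached 1. *)
Lemma bump_ge0_le1 a b k t : 0 < k -> a + k^-1 <= b -> 0 <= bump a b k t <= 1.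
Proof.
move=> k0 akb; rewrite /bump.
have [tb|tb] := leP t b.
  by rewrite (ramp_eq0 ((t - b) * k)) ?subr0 ?ramp_ge0 ?ramp_le1// mulr_le0_ge0 ?subr_le0// ltW.
rewrite (ramp_eq1 ((t - a) * k)); last first.
  by rewrite -ler_pdivrMr// mul1r; lra.
by rewrite subr_ge0 ramp_le1 gerBl ramp_ge0.
Qed.

Lemma space_time_bump_test r a b k : 0 < r -> 0 < a -> 0 < k ->
  a <= b -> b + k^-1 < 1 -> test_fun (space_time_bump r a b k).
Proof.
move=> r0 a0 k0 ab bk; split.
  apply: elementary_smooth.
  have e2 c : elementary (fun p : vec R d * R => (p.2 - c) * k).
    apply: el_mul; last exact: el_cst.
    apply: el_add; last exact: el_cst.
    by apply: el_linear => //; move=> p; exact: cvg_snd.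
  apply: el_mul.
    apply: cutoff_elementary => i; apply: el_linear => [c x y|p].
      exact: coord_linear.
    apply: (@continuous_comp _ _ _ fst (fun x : vec R d => x ord0 i)).
      exact: cvg_fst.
    exact: continuous_coord.
  rewrite (_ : (fun _ => _) = (fun p : vec R d * R =>
     (ramp \o (fun p => (p.2 - a) * k)) p + (-1) * (ramp \o (fun p => (p.2 - b) * k)) p)).
    by apply: el_add; [exact: el_ramp|apply: el_mul; [exact: el_cst|exact: el_ramp]].
  by apply/funext => p; rewrite mulN1r.
exists r, a, (b + k^-1); split => // x t [rx|[ta|bt]]; rewrite /space_time_bump/=.
- by rewrite cutoff_eq0 ?mul0r// ltW.
- rewrite /bump !ramp_eq0 ?subrr ?mulr0// mulr_le0_ge0// ?subr_le0 ?(ltW k0)//; apply/ltW => //.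
  exact: lt_le_trans ab.
- rewrite /bump !ramp_eq1 ?subrr ?mulr0// -ler_pdivrMr// mul1r; lra.
Qed.

Definition bump' a b k t : R := ramp' ((t - a) * k) * k - ramp' ((t - b) * k) * k.

Lemma dt_space_time_bump r a b k x t :
  dt_fun (space_time_bump r a b k) x t = cutoff r x * bump' a b k t.
Proof.
have H : is_derive t 1 (fun s => bump a b k s) (bump' a b k t).
  by apply: is_deriveB; exact: is_derive_ramp_affine.
rewrite /dt_fun /space_time_bump/= deriveM; [|exact: derivable_cst|by case: H].
by rewrite derive_cst scaler0 addr0; case: H => _ ->.
Qed.

Lemma grad_space_time_bump r a b k x t i :
  grad_x (space_time_bump r a b k) x t ord0 i = bump a b k t * dcutoff r i x.
Proof.
rewrite mxE /space_time_bump/= deriveM; [|exact/diff_derivable/differentiable_cutoff|exact: derivable_cst].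
by rewrite derive_cst scaler0 add0r derive_cutoff.
Qed.

(** Fundamental theorem of calculus: both ramps go from 0 at time 0 to 1 at time 1. The weights are
    separate because the mass will be replaced by one constant on the rise and by another on the
    fall. *)
Lemma integral_bump' a b k c c' : 0 < a -> 0 < k -> a <= b -> b + k^-1 < 1 ->
  (\int[@leb R]_(t in @I01 R) (c * (ramp' ((t - a) * k) * k) - c' * (ramp' ((t - b) * k) * k))%:E
   = (c - c')%:E)%E.
Proof.
move=> a0 k0 ab bk1.
have k'0 : 0 < k^-1 by rewrite invr_gt0.
pose F t := c * ramp ((t - a) * k) - c' * ramp ((t - b) * k).
pose f t := c * (ramp' ((t - a) * k) * k) - c' * (ramp' ((t - b) * k) * k).
have dF t : is_derive t 1 F (f t).
  have d1 := is_derive_ramp_affine a k t.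
  have d2 := is_derive_ramp_affine b k t.
  exact: is_derive_eq.
have cF : continuous F.
  move=> t; apply: differentiable_continuous; apply/derivable1_diffP; by case: (dF t).
have cr e : continuous (fun t => ramp' ((t - e) * k)).
  move=> t; apply: (@continuous_comp _ _ _ (fun t => (t - e) * k) ramp'); last exact: continuous_ramp'.
  by apply: cvgM; [apply: cvgB; [exact: cvg_id|exact: cvg_cst]|exact: cvg_cst].
have cf : continuous f.
  move=> t; apply: cvgB; apply: cvgM; rewrite /continuous_at; do ?exact: cvg_cst;
   by apply: cvgM; [exact: cr|exact: cvg_cst].
have FTC : (\int[@leb R]_(t in `[0%R, 1%R]) (f t)%:E = (F 1)%:E - (F 0)%:E)%E.
  apply: continuous_FTC2 => //.
  - exact: continuous_subspaceT.
  - split.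
    + by move=> t _; case: (dF t).
    + by apply: cvg_at_right_filter; exact: cF.
    + by apply: cvg_at_left_filter; exact: cF.
  - by move=> t _; rewrite derive1E; case: (dF t).
rewrite integral_itv_bndoo in FTC; last first.
  by apply/measurable_EFinP/measurable_funTS; exact: continuous_measurable_fun.
have h1 : ramp ((1 - a) * k) = 1 by apply: ramp_eq1; rewrite -ler_pdivrMr// mul1r; lra.
have h2 : ramp ((1 - b) * k) = 1 by apply: ramp_eq1; rewrite -ler_pdivrMr// mul1r; lra.
have h3 : ramp ((0 - a) * k) = 0.
  by apply: ramp_eq0; rewrite mulr_le0_ge0 ?(ltW k0)// subr_le0 ltW.
have h4 : ramp ((0 - b) * k) = 0.
  by apply: ramp_eq0; rewrite mulr_le0_ge0 ?(ltW k0)// subr_le0 (le_trans (ltW a0)).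
by rewrite /I01 FTC /F h1 h2 h3 h4 !mulr1 !mulr0 subr0 sube0.
Qed.

End test_function.

(** * Lower integrals and densities *)

Section lower_integral.
Local Open Scope ereal_scope.
Context {d} {T : measurableType d} {R : realType} (mu : {measure set T -> \bar R}).
Implicit Types (f g : T -> \bar R) (D : set T).
Import HBNNSimple.

Lemma le_lower_integral D f g : (forall x, D x -> 0 <= f x) ->
  (forall x, D x -> f x <= g x) ->
  \int[mu]_(x in D) f x <= \int[mu]_(x in D) g x.
Proof.
move=> f0 fg.
have g0 x : D x -> 0 <= g x by move=> Dx; exact: le_trans (f0 x Dx) (fg x Dx).
rewrite !ge0_integralE//; apply: ge_ereal_sup => _ [h hf <-].
apply: ereal_sup_ubound; exists h => // x.
apply: le_trans (hf x) _; rewrite /patch; case: ifPn => // xD.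
by apply: fg; rewrite inE in xD.
Qed.

(** For a simple function h below f, the measurable function u = a^-1 max(0, h - k) lies below g,
    and h <= a u + k. Additivity of the integral is applied to u and k only, never to f or g. *)
Let le_integral_affineT f g (k : T -> R) (a : R) : (0 < a)%R ->
  (forall x, 0 <= f x) -> (forall x, 0 <= g x) ->
  measurable_fun setT k -> (forall x, 0 <= k x)%R ->
  (forall x, f x <= a%:E * g x + (k x)%:E) ->
  \int[mu]_x f x <= a%:E * \int[mu]_x g x + \int[mu]_x (k x)%:E.
Proof.
move=> a0 f0 g0 mk k0 fgk.
rewrite ge0_integralTE//; apply: ge_ereal_sup => _ [h hf <-].
rewrite -[h : T -> R](@patch_setT _ _ (fun=> 0%R)) -integral_nnsfun//.
pose u x : R := (a^-1 * Num.max 0 (h x - k x))%R.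
have mu0 : measurable_fun setT (fun x => Num.max 0%R (h x - k x)%R).
  apply: measurable_maxr => //; exact: measurable_funB.
have mu_ : measurable_fun setT u by exact: measurable_funM.
have u0 x : (0 <= u x)%R by rewrite mulr_ge0 ?invr_ge0 ?(ltW a0)// le_max lexx.
apply: (@le_trans _ _ (\int[mu]_x (a%:E * (u x)%:E + (k x)%:E))).
  apply: le_lower_integral => x _; first by rewrite lee_fin.
  rewrite -EFinM -EFinD lee_fin /u mulrA mulfV ?gt_eqF// mul1r.
  have : (h x - k x <= Num.max 0 (h x - k x))%R by rewrite le_max lexx orbT.
  by rewrite lerBlDr.
rewrite ge0_integralD//; last 4 first.
  by move=> x _; rewrite -EFinM lee_fin mulr_ge0// ltW.
  by apply: measurable_funeM; exact/measurable_EFinP.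
  by move=> x _; rewrite lee_fin.
  exact/measurable_EFinP.
rewrite leeD2r// ge0_integralZl//; last 3 first.
  exact/measurable_EFinP.
  by move=> x _; rewrite lee_fin.
  by rewrite lee_fin ltW.
rewrite lee_pmul2l ?lte_fin//.
apply: le_lower_integral => x _; first by rewrite lee_fin.
have := le_trans (hf x) (fgk x); have := g0 x.
case: (g x) => [y|_ _|//]; last by rewrite leey.
rewrite -EFinM -EFinD !lee_fin /u => y0 hy.
by rewrite ler_pdivrMl// ge_max mulr_ge0 ?(ltW a0)//= lerBlDr.
Qed.

Lemma le_integral_affine D f g (k : T -> R) (a : R) : measurable D -> (0 < a)%R ->
  (forall x, D x -> 0 <= f x) -> (forall x, D x -> 0 <= g x) ->
  measurable_fun D k -> (forall x, D x -> 0 <= k x)%R ->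
  (forall x, D x -> f x <= a%:E * g x + (k x)%:E) ->
  \int[mu]_(x in D) f x <= a%:E * \int[mu]_(x in D) g x + \int[mu]_(x in D) (k x)%:E.
Proof.
move=> mD a0 f0 g0 mk k0 fgk.
rewrite !(integral_mkcond D).
have -> : ((fun x => (k x)%:E) \_ D) = (fun x => (((k \_ D) : T -> R) x)%:E).
  by apply/funext => x; rewrite /patch; case: ifPn.
apply: le_integral_affineT => //.
- by move=> x; rewrite /patch; case: ifPn => // xD; apply: f0; rewrite inE in xD.
- by move=> x; rewrite /patch; case: ifPn => // xD; apply: g0; rewrite inE in xD.
- by apply/(measurable_restrictT _ _).1.
- by move=> x; rewrite /patch; case: ifPn => // xD; apply: k0; rewrite inE in xD.
- move=> x; rewrite /patch; case: ifPn => xD; last by rewrite mule0 adde0.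
  by apply: fgk; rewrite inE in xD.
Qed.

End lower_integral.

(** * Measures with a density *)

Section density.
Local Open Scope ereal_scope.
Context {d} {T : measurableType d} {R : realType}.

(** The proofs [mf] and [f0] are arguments so that the set function can be declared a measure; an
    inequality between measures can then be integrated against a weight. *)
Definition density (mu : {measure set T -> \bar R}) (f : T -> R)
  (mf : measurable_fun setT f) (f0 : forall x, (0 <= f x)%R) (A : set T) : \bar R :=
  \int[mu]_(x in A) (f x)%:E.

Variables (mu : {measure set T -> \bar R}) (f : T -> R).
Hypotheses (mf : measurable_fun setT f) (f0 : forall x, (0 <= f x)%R).

Let density0 : density mu f mf f0 set0 = 0.
Proof. exact: integral_set0. Qed.

Let density_ge0 A : 0 <= density mu f mf f0 A.
Proof. by apply: integral_ge0 => x _; rewrite lee_fin. Qed.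

Let density_sigma_additive : semi_sigma_additive (density mu f mf f0).
Proof.
move=> F Fm tF mbF; rewrite /density ge0_integral_bigcup//.
- apply: is_cvg_ereal_nneg_natsum_cond => n _ _.
  by apply: integral_ge0 => x _; rewrite lee_fin.
- by apply/measurable_EFinP; exact: measurable_funTS.
- by move=> x _; rewrite lee_fin.
Qed.

HB.instance Definition _ := isMeasure.Build _ _ _ (density mu f mf f0)
  density0 density_ge0 density_sigma_additive.

Import HBNNSimple.

Let integral_density_nnsfun (h : {nnsfun T >-> R}) :
  \int[density mu f mf f0]_x (h x)%:E = \int[mu]_x (h x * f x)%:E.
Proof.
have mI r : measurable (h @^-1` [set r]) by [].
have m1 r : measurable_fun [set: T] (fun x => \1_(h @^-1` [set r]) x * f x)%R.
  by apply: measurable_funM.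
rewrite integral_nnsfun// patch_setT sintegralE.
transitivity (\sum_(r \in range h) \int[mu]_x (r * \1_(h @^-1` [set r]) x * f x)%:E).
  apply: eq_fsbigr => r1; rewrite inE => -[t _ <-] {r1}.
  set r := h t; have r0 : (0 <= r)%R by [].
  transitivity (r%:E * \int[mu]_x (\1_(h @^-1` [set r]) x * f x)%:E).
    congr (_ * _); rewrite [LHS]integral_mkcond; apply: eq_integral => x _.
    rewrite /patch indicE; case: ifPn => xr; first by rewrite mul1r.
    by rewrite mul0r.
  under [RHS]eq_integral do rewrite -mulrA EFinM.
  rewrite ge0_integralZl//; first exact/measurable_EFinP.
  by move=> x _; rewrite lee_fin mulr_ge0 ?f0.
have mm r : measurable_fun [set: T] (fun x => (r * \1_(h @^-1` [set r]) x * f x)%:E).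
  apply/measurable_EFinP; apply: measurable_funM => //; exact: measurable_funM.
rewrite -ge0_integral_fsum//.
  apply: eq_integral => x _; rewrite fsumEFin//; congr _%:E.
  by rewrite [in RHS]fimfunE !fsbig_finite//= mulr_suml.
move=> r x _; rewrite lee_fin mulr_ge0// indicE.
have [|] := boolP (x \in _); last by rewrite mulr0.
by rewrite inE /= => <-; rewrite mulr_ge0.
Qed.

(** Monotone convergence on both sides along the same simple functions increasing to g. *)
Lemma integral_density (g : T -> \bar R) : measurable_fun setT g -> (forall x, 0 <= g x) ->
  \int[density mu f mf f0]_x g x = \int[mu]_x (g x * (f x)%:E).
Proof.
move=> mg g0.
pose h := nnsfun_approx measurableT mg.
have hg x : (h n x)%:E @[n --> \oo] --> g x.
  by apply: cvg_nnsfun_approx => // y _; exact: g0.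
have c1 : \int[density mu f mf f0]_x (h n x)%:E @[n --> \oo] --> \int[density mu f mf f0]_x g x.
  rewrite (_ : \int[_]_x g x = \int[density mu f mf f0]_x (limn (fun n => (h n x)%:E))); last first.
    by apply: eq_integral => x _; apply/esym/cvg_lim => //; exact: hg.
  apply: (@cvg_monotone_convergence _ _ _ _ _ measurableT (fun n x => (h n x)%:E)) => //.
  - by move=> n; exact/measurable_EFinP.
  - by move=> n x _; rewrite lee_fin.
  - by move=> x _ n m nm; rewrite lee_fin; exact/lefP/nd_nnsfun_approx.
have c2 : \int[mu]_x (h n x * f x)%:E @[n --> \oo] --> \int[mu]_x (g x * (f x)%:E).
  rewrite (_ : \int[_]_x (g x * _) = \int[mu]_x (limn (fun n => (h n x * f x)%:E))); last first.
    apply: eq_integral => x _; apply/esym/cvg_lim => //.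
    under eq_fun do rewrite EFinM.
    by apply: cvgeZr => //; exact: hg.
  apply: (@cvg_monotone_convergence _ _ _ _ _ measurableT (fun n x => (h n x * f x)%:E)) => //.
  - by move=> n; apply/measurable_EFinP; exact: measurable_funM.
  - by move=> n x _; rewrite lee_fin mulr_ge0.
  - move=> x _ n m nm; rewrite lee_fin ler_wpM2r//; exact/lefP/nd_nnsfun_approx.
have e : (fun n => \int[density mu f mf f0]_x (h n x)%:E) = (fun n => \int[mu]_x (h n x * f x)%:E).
  by apply/funext => n; exact: integral_density_nnsfun.
by rewrite e in c1; apply: cvg_unique c1 c2.
Qed.

End density.

(** * The integrand of the action *)

Section integrand.
Context {R : realType} {d : nat}.
Implicit Types (s b rho : R) (w : vec R d).

Lemma theta_sub s b : theta s b - s = - (b * (s - 1)).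
Proof. rewrite /theta; ring. Qed.

Lemma phi_pos_eq0 s b rho w : 0 < s -> enorm w = 0 -> phi_pos s b rho w = 0.
Proof. by move=> s0 w0; rewrite /phi_pos w0 powR0 ?mulr0// gt_eqF. Qed.

Lemma phi_eq0 s b rho w : 0 < s -> enorm w = 0 -> phi s b rho w = 0%E.
Proof.
move=> s0 w0; rewrite /phi; case: ifPn => _; first by rewrite phi_pos_eq0.
by under eq_fun do rewrite phi_pos_eq0//; rewrite lim_cst.
Qed.

Lemma phi_b0 s rho w : phi s 0 rho w = (enorm w `^ s)%:E.
Proof.
have E r : phi_pos s 0 r w = enorm w `^ s.
  by rewrite /phi_pos theta_sub mul0r oppr0 powRr0 mul1r.
rewrite /phi; case: ifPn => _; first by rewrite E.
by under eq_fun do rewrite E; rewrite lim_cst.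
Qed.

Lemma phi0_pinfty s b w : 1 < s -> 0 < b -> 0 < enorm w -> phi s b 0 w = +oo%E.
Proof.
move=> s1 b0 w0; rewrite /phi ltxx; apply/cvg_lim => //; apply/cvgeyPge => A.
have c0 : 0 < b * (s - 1) by rewrite mulr_gt0// subr_gt0.
have K0 : 0 < enorm w `^ s by exact: powR_gt0.
have A0 : 0 < `|A| + 1 by rewrite ltr_wpDl.
have h := (@cvgrPdist_le _ _ _ _ _ _ _).1 (@powR_cvg0 R _ c0) _ (divr_gt0 K0 A0).
near=> r.
have r0 : 0 < r by near: r; exact: nbhs_right_gt.
have rc0 : 0 < r `^ (b * (s - 1)) by exact: powR_gt0.
rewrite lee_fin /phi_pos theta_sub powRN.
rewrite mulrC ler_pdivlMr//.
have : r `^ (b * (s - 1)) <= enorm w `^ s / (`|A| + 1).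
  apply: le_trans (ler_norm _) _; rewrite -normrN -(sub0r (_ `^ _)).
  by near: r; exact: h.
rewrite ler_pdivlMr// mulrC; apply: le_trans.
rewrite ler_wpM2r ?(ltW rc0)//; apply: le_trans (ler_norm _) _; by rewrite lerDl.
Unshelve. all: by end_near. Qed.

Lemma phi_ge0 s b rho w : 1 < s -> 0 <= b -> 0 <= rho -> (0 <= phi s b rho w)%E.
Proof.
move=> s1 b0; rewrite le_eqVlt => /predU1P[<-|rho0]; last first.
  by rewrite /phi rho0 lee_fin mulr_ge0// powR_ge0.
have := enorm_ge0 w; rewrite le_eqVlt => /predU1P[/esym w0|w0].
  by rewrite phi_eq0// (lt_trans _ s1).
move: b0; rewrite le_eqVlt => /predU1P[<-|b0].
  by rewrite phi_b0 lee_fin powR_ge0.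
by rewrite phi0_pinfty// leey.
Qed.

(** The integrand is nonincreasing in rho, so its value at m is a lower bound; the limit value at
    rho = 0 obeys the same bound, which allows a uniform treatment of a vanishing density. *)
Lemma phi_ge s b rho m w : 1 < s -> 0 <= b -> 0 <= rho -> rho <= m -> 0 < m ->
  ((m `^ (- (b * (s - 1))) * enorm w `^ s)%:E <= phi s b rho w)%E.
Proof.
move=> s1 b0; rewrite le_eqVlt => /predU1P[<- _ m0|rho0 rhom m0]; last first.
  rewrite /phi rho0 lee_fin /phi_pos theta_sub ler_wpM2r ?powR_ge0//.
  rewrite !powRN lef_pV2 ?posrE ?powR_gt0//.
  by apply: ge0_ler_powR; rewrite ?nnegrE ?(ltW m0) ?(ltW rho0)// mulr_ge0// subr_ge0 ltW.
have := enorm_ge0 w; rewrite le_eqVlt => /predU1P[/esym w0|w0].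
  by rewrite phi_eq0 ?(lt_trans _ s1)// w0 powR0 ?mulr0// gt_eqF// (lt_trans _ s1).
move: b0; rewrite le_eqVlt => /predU1P[<-|b0].
  by rewrite phi_b0 mul0r oppr0 powRr0 mul1r.
by rewrite phi0_pinfty// leey.
Qed.

(** For w <> 0 the rescaled integrand grows at least like l^((1-b)(s-1)), a positive power because b
    < 1 and s > 1. The limit involves neither s nor b nor rho, hence is common to both actions. *)
Lemma phi_recE s b rho w : 1 < s -> 0 <= b -> b < 1 -> 0 <= rho ->
  phi_rec s b rho w = if enorm w == 0 then 0%E else +oo%E.
Proof.
move=> s1 b0 b1 rho0; have s0 : 0 < s by exact: lt_trans s1.
case: ifPn => [/eqP w0|wn0].
  rewrite /phi_rec; apply/cvg_lim => //.
  apply: cvg_near_cst.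
  near=> l; have l0 : 0 <= l by near: l; exact: nbhs_pinfty_ge.
  by rewrite phi_eq0 ?mule0// enormZ// w0 mulr0.
have w0 : 0 < enorm w by rewrite lt_neqAle eq_sym wn0 enorm_ge0.
rewrite /phi_rec; apply/cvg_lim => //; apply/cvgeyPge => A.
(* The maximum with 1 keeps [m] positive when [rho] is 0, as [phi_ge] requires. *)
pose m := Num.max rho 1.
have m0 : 0 < m by rewrite lt_max ltr01 orbT.
pose K := m `^ (- (b * (s - 1))) * enorm w `^ s.
have K0 : 0 < K by rewrite mulr_gt0// powR_gt0.
have e0 : 0 < (1 - b) * (s - 1) by rewrite mulr_gt0// subr_gt0.
near=> l.
have l0 : 0 < l by near: l; exact: nbhs_pinfty_gt.
have h1 : ((K * l `^ ((1 - b) * (s - 1)))%:E <= (l^-1)%:E * phi s b (l * rho) (l *: w))%E.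
  rewrite lee_pdivlMl//.
  apply: le_trans (phi_ge s b (l * rho) (l * m) (l *: w) s1 b0 _ _ _).
  - rewrite -EFinM lee_fin enormZ ?(ltW l0)// !powRM ?(ltW l0) ?(ltW m0) ?(ltW w0)//.
    rewrite le_eqVlt; apply/orP; left; apply/eqP.
    have -> : l * (K * l `^ ((1 - b) * (s - 1))) = K * (l `^ 1 * l `^ ((1 - b) * (s - 1))).
      rewrite powRr1 ?(ltW l0)//; ring.
    rewrite -powRD; last by rewrite (gt_eqF l0) implybT.
    have -> : 1 + (1 - b) * (s - 1) = - (b * (s - 1)) + s by ring.
    rewrite powRD; last by rewrite (gt_eqF l0) implybT.
    by rewrite /K; ring.
  - by rewrite mulr_ge0// ltW.
  - by rewrite ler_pM2l// le_max lexx.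
  - by rewrite mulr_gt0.
apply: le_trans h1; rewrite lee_fin -ler_pdivrMl//.
have h2 : (`|K^-1 * A| `^ ((1 - b) * (s - 1))^-1) <= l.
  by near: l; exact: nbhs_pinfty_ge.
apply: le_trans (ler_norm _) _.
have -> : `|K^-1 * A| = (`|K^-1 * A| `^ ((1 - b) * (s - 1))^-1) `^ ((1 - b) * (s - 1)).
  by rewrite -powRrM mulVf ?gt_eqF// powRr1.
by apply: ge0_ler_powR => //; rewrite ?nnegrE ?powR_ge0 ?(ltW l0) ?(ltW e0).
Unshelve. all: by end_near. Qed.

(** Solving f = rho^(-a(p-1)) |w|^p for |w| gives one formula for all finite values, including those
    at rho = 0, so that the Young inequalities need no case analysis of their own. *)
Lemma phi_cases p a rho w : 1 < p -> 0 <= a -> 0 <= rho ->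
  phi p a rho w = +oo%E \/
  exists2 f, 0 <= f & phi p a rho w = f%:E /\
    enorm w = f `^ p^-1 * rho `^ (a * (p - 1) / p).
Proof.
move=> p1 a0; have p0 : 0 < p by exact: lt_trans p1.
have rootK x : 0 <= x -> (x `^ p) `^ p^-1 = x.
  by move=> x0; rewrite -powRrM mulfV ?gt_eqF// powRr1.
rewrite le_eqVlt => /predU1P[<-|rho0]; last first.
  right; exists (phi_pos p a rho w); first by rewrite mulr_ge0// powR_ge0.
  split; first by rewrite /phi rho0.
  rewrite /phi_pos theta_sub powRM ?powR_ge0// rootK ?enorm_ge0// mulrAC -powRrM mulNr.
  by rewrite powRN mulVf ?mul1r// powR_eq0 (gt_eqF rho0).
have := enorm_ge0 w; rewrite le_eqVlt => /predU1P[/esym w0|w0].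
  right; exists 0 => //; rewrite phi_eq0// w0; split => //.
  by rewrite powR0 ?mul0r// invr_eq0 gt_eqF.
move: a0; rewrite le_eqVlt => /predU1P[<-|b0].
  right; exists (enorm w `^ p); first exact: powR_ge0.
  by rewrite phi_b0 rootK ?enorm_ge0// !mul0r powRr0 mulr1.
by left; rewrite phi0_pinfty.
Qed.

(** Conjugate exponents 1/q and 1/(1-q) applied to c^(q-1) x and c^q y: the powers of c cancel in
    the product, since (q-1) q + q (1-q) = 0. The case q = 1, where the second exponent degenerates,
    is separate. *)
Lemma young (q x y c : R) : 0 < q -> q <= 1 -> 0 <= x -> 0 <= y -> 0 < c ->
  x `^ q * y `^ (1 - q) <= q * c `^ (q - 1) * x + (1 - q) * c `^ q * y.
Proof.
move=> q0 q1 x0 y0 c0.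
move: q1; rewrite le_eqVlt => /predU1P[->|q1].
  by rewrite subrr !powRr0 powRr1//; lra.
have q10 : 0 < 1 - q by rewrite subr_gt0.
have := @conjugate_powR R ((c `^ (q - 1) * x) `^ q) ((c `^ q * y) `^ (1 - q)) q^-1 (1 - q)^-1.
rewrite !powR_ge0 !invr_gt0 q0 q10 !invrK subrKC => /(_ isT isT isT isT erefl).
rewrite -!powRrM !mulfV ?gt_eqF// !powRr1; last 2 first.
  by rewrite mulr_ge0// powR_ge0.
  by rewrite mulr_ge0// powR_ge0.
rewrite (mulrC _ q) (mulrC _ (1 - q)) !mulrA; apply: le_trans.
rewrite !powRM ?powR_ge0// mulrACA -!powRrM -powRD; last by rewrite (gt_eqF c0) implybT.
have -> : (q - 1) * q + q * (1 - q) = 0 by ring.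
by rewrite powRr0 mul1r.
Qed.

Lemma phi_young p a rho w c q : 1 < p -> 0 <= a -> 0 <= rho -> 0 < c ->
  q = (1 + a * (p - 1))^-1 ->
  (phi (p * q) 0 rho w <=
     (q * c `^ (q - 1))%:E * phi p a rho w + ((1 - q) * c `^ q * rho)%:E)%E.
Proof.
move=> p1 a0 rho0 c0 qE; have p0 : 0 < p by exact: lt_trans p1.
have D0 : 1 <= 1 + a * (p - 1) by rewrite lerDl mulr_ge0// subr_ge0 ltW.
have D1 : 0 < 1 + a * (p - 1) by exact: lt_le_trans D0.
have q0 : 0 < q by rewrite qE invr_gt0.
have q1 : q <= 1 by rewrite qE invf_le1.
have qc : 0 < q * c `^ (q - 1) by rewrite mulr_gt0// powR_gt0.
rewrite phi_b0.
have [->|[f f0 [-> ->]]] := phi_cases p a rho w p1 a0 rho0.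
  by rewrite gt0_muley ?lte_fin// addye// leey.
rewrite -EFinM -EFinD lee_fin.
rewrite powRM ?powR_ge0// -!powRrM (mulrA p^-1) mulVf ?gt_eqF// mul1r.
(* This identity determines q: the exponents of the action density and of [rho] then add up to 1. *)
have -> : a * (p - 1) / p * (p * q) = 1 - q.
  rewrite mulrA mulfVK ?gt_eqF//.
  have Dq : (1 + a * (p - 1)) * q = 1 by rewrite qE mulfV ?gt_eqF.
  by rewrite -[X in _ = X - _]Dq; ring.
exact: young.
Qed.

Lemma prod_powR_le (x y z u v t m : R) : 0 <= x -> 0 <= y -> 0 <= z ->
  0 <= u -> 0 <= v -> 0 <= t -> u + v + t = 1 ->
  x <= m -> y <= m -> z <= m -> x `^ u * y `^ v * z `^ t <= m.
Proof.
move=> x0 y0 z0 u0 v0 t0 uvt xm ym zm.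
have m0 : 0 <= m by exact: le_trans xm.
have -> : m = m `^ u * m `^ v * m `^ t.
  move: m0; rewrite le_eqVlt => /predU1P[<-|m0]; last first.
    by rewrite -!powRD ?(gt_eqF m0) ?implybT// uvt powRr1// ltW.
  have [ue|un0] := eqVneq u 0; last by rewrite (powR0 un0) !mul0r.
  have [ve|vn0] := eqVneq v 0; last by rewrite (powR0 vn0) mulr0 mul0r.
  have [te|tn0] := eqVneq t 0; last by rewrite (powR0 tn0) mulr0.
  by move: uvt; rewrite ue ve te; lra.
have H (g e : R) : 0 <= g -> 0 <= e -> g <= m -> g `^ e <= m `^ e.
  by move=> g0 e0 gm; apply: ge0_ler_powR; rewrite ?nnegrE.
apply: ler_pM; rewrite ?mulr_ge0 ?powR_ge0//; last exact: H.
by apply: ler_pM; rewrite ?powR_ge0//; exact: H.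
Qed.

(** In the three-factor product the powers of lam cancel, 1/p + b + (1-kappa)/kappa = 0. A small lam
    therefore makes the first two terms small, while the price lam^(1-kappa) is carried only by the
    term that vanishes as r grows. *)
Lemma enorm_le_phi p a rho w chi r lam kappa b : 1 < p -> 0 <= a -> a < 1 -> 0 <= rho ->
  0 <= chi -> 0 < r -> 0 < lam ->
  kappa = p / ((1 - a) * (p - 1)) -> b = a * (p - 1) / p ->
  ((r^-1 * chi `^ b * enorm w)%:E <=
   lam%:E * phi p a rho w + (lam * chi * rho + lam `^ (1 - kappa) * r `^ (- kappa))%:E)%E.
Proof.
move=> p1 a0 a1 rho0 chi0 r0 l0 kE bE; have p0 : 0 < p by exact: lt_trans p1.
have p10 : 0 < p - 1 by rewrite subr_gt0.
have k0 : 0 < kappa by rewrite kE divr_gt0// mulr_gt0// subr_gt0.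
have b0 : 0 <= b by rewrite bE divr_ge0 ?(ltW p0)// mulr_ge0// ltW.
have [->|[f f0 [-> ->]]] := phi_cases p a rho w p1 a0 rho0.
  by rewrite gt0_muley ?lte_fin// addye// leey.
rewrite -EFinM -EFinD lee_fin -bE.
have kk : kappa^-1 = (1 - a) * (p - 1) / p by rewrite kE invfM invrK mulrC.
have sum1 : p^-1 + b + kappa^-1 = 1.
  by rewrite kk bE; field; rewrite gt_eqF.
(* The left side is [X^(1/p) Y^b Z^(1/kappa)], and the exponents add up to 1. *)
set X := lam * f; set Y := lam * chi * rho; set Z := lam `^ (1 - kappa) * r `^ (- kappa).
have X0 : 0 <= X by rewrite mulr_ge0// ltW.
have Y0 : 0 <= Y by rewrite !mulr_ge0// ltW.
have Z0 : 0 <= Z by rewrite mulr_ge0// powR_ge0.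
have -> : r^-1 * chi `^ b * (f `^ p^-1 * rho `^ b) = X `^ p^-1 * Y `^ b * Z `^ kappa^-1.
  rewrite /X /Y /Z !powRM ?powR_ge0 ?mulr_ge0 ?(ltW l0)//.
  rewrite -!powRrM mulNr mulfV ?gt_eqF// powR_inv1 ?(ltW r0)//.
  have -> : (1 - kappa) / kappa = - (p^-1 + b).
    by rewrite mulrBl mulfV ?gt_eqF//; lra.
  rewrite powRN powRD ?(gt_eqF l0) ?implybT//.
  have l1 : lam `^ p^-1 != 0 by rewrite powR_eq0 (gt_eqF l0).
  have l2 : lam `^ b != 0 by rewrite powR_eq0 (gt_eqF l0).
  by field; rewrite l1 l2 gt_eqF.
by apply: prod_powR_le; rewrite ?invr_ge0 ?(ltW p0) ?(ltW k0)//; lra.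
Qed.

End integrand.

(** * Comparison of vector measures *)

Section absolute_domination.
Local Open Scope ereal_scope.
Context {d} {T : measurableType d} {R : realType}.
Variables (lam gam sig : {measure set T -> \bar R}) (D : set T) (n w v : T -> R).
Hypotheses (mD : measurable D) (mn : measurable_fun setT n)
  (mw : measurable_fun setT w) (mv : measurable_fun setT v).
Hypothesis nwv : forall A, measurable A -> A `<=` D ->
  \int[lam]_(x in A) (n x)%:E = \int[gam]_(x in A) (w x)%:E + \int[sig]_(x in A) (v x)%:E.

(** On a set where n keeps its sign, the integral of |n| is the absolute value of the integral of n,
    to which the identity of the signed measures applies. *)
Let abs_const_sign A : measurable A -> A `<=` D ->
  ((forall x, A x -> 0 <= n x) \/ (forall x, A x -> n x <= 0))%R ->
  \int[lam]_(x in A) `|n x|%:E <=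
  \int[gam]_(x in A) `|w x|%:E + \int[sig]_(x in A) `|v x|%:E.
Proof.
move=> mA AD sgn.
have -> : \int[lam]_(x in A) `|n x|%:E = `| \int[lam]_(x in A) (n x)%:E |.
  case: sgn => sgn.
    rewrite gee0_abs; last by apply: integral_ge0 => x Ax; rewrite lee_fin sgn.
    by apply: eq_integral => x; rewrite inE => Ax; rewrite ger0_norm// sgn.
  have -> : \int[lam]_(x in A) (n x)%:E = - \int[lam]_(x in A) (- n x)%:E.
    rewrite -integral_ge0N; first by apply: eq_integral => x _; rewrite EFinN oppeK.
    by move=> x Ax; rewrite lee_fin oppr_ge0 sgn.
  rewrite abseN.
  rewrite gee0_abs; last by apply: integral_ge0 => x Ax; rewrite lee_fin oppr_ge0 sgn.
  by apply: eq_integral => x; rewrite inE => Ax; rewrite ler0_norm// sgn.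
rewrite nwv//; apply: le_trans (lee_abs_add _ _) _.
by apply: leeD; apply: le_abse_integral => //; apply/measurable_EFinP; exact: measurable_funTS.
Qed.

(** A Hahn decomposition for n alone suffices: on each piece w and v may change sign, since only the
    triangle inequality is applied to them. *)
Lemma abs_domination A : measurable A -> A `<=` D ->
  \int[lam]_(x in A) `|n x|%:E <=
  \int[gam]_(x in A) `|w x|%:E + \int[sig]_(x in A) `|v x|%:E.
Proof.
move=> mA AD.
pose P := A `&` (n @^-1` `[0%R, +oo[); pose N := A `&` (n @^-1` `]-oo, 0%R[).
have mP : measurable P by apply: measurableI => //; rewrite -[X in measurable X]setTI; exact: mn.
have mN : measurable N by apply: measurableI => //; rewrite -[X in measurable X]setTI; exact: mn.
have AE : A = P `|` N.
  rewrite -setIUr -preimage_setU (_ : _ `|` _ = setT) ?preimage_setT ?setIT//.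
  apply/seteqP; split => // x _ /=; rewrite !in_itv/= andbT.
  by have [] := ltP x 0%R; [right|left].
have dPN : [disjoint P & N].
  apply/disj_setPS => x [[_ /=]]; rewrite in_itv/= andbT => x0 [_ /=].
  by rewrite in_itv/= ltNge x0.
have PD : P `<=` D by apply: subset_trans AD; exact: subIsetl.
have ND : N `<=` D by apply: subset_trans AD; exact: subIsetl.
have mabs (f : T -> R) (E : set T) : measurable_fun setT f -> measurable_fun E (fun x => `|f x|%:E).
  by move=> mf; apply/measurable_EFinP; apply: measurable_funTS; exact: measurableT_comp.
rewrite AE !ge0_integral_setU//; do ?exact: mabs.
have hP : \int[lam]_(x in P) `|n x|%:E <=
  \int[gam]_(x in P) `|w x|%:E + \int[sig]_(x in P) `|v x|%:E.
  by apply: abs_const_sign => //; left => x [_ /=]; rewrite in_itv/= andbT.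
have hN : \int[lam]_(x in N) `|n x|%:E <=
  \int[gam]_(x in N) `|w x|%:E + \int[sig]_(x in N) `|v x|%:E.
  by apply: abs_const_sign => //; right => x [_ /=]; rewrite in_itv/= => /ltW.
by rewrite addeACA; exact: leeD.
Qed.

(** The set inequality says that |n| 1_D lam is dominated by |w| 1_D gam + |v| 1_D sig as measures;
    integrating g against both sides gives the claim. The set D is there because vector measures are
    compared on bounded sets only. *)
Lemma weighted_abs_domination (g : T -> R) : measurable_fun setT g ->
  (forall x, 0 <= g x)%R -> (forall x, ~ D x -> g x = 0%R) ->
  \int[lam]_x (g x * `|n x|)%:E <=
  \int[gam]_x (g x * `|w x|)%:E + \int[sig]_x (g x * `|v x|)%:E.
Proof.
move=> mg g0 gD.
pose r (f : T -> R) := (fun x => `|f x| * \1_D x)%R.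
have mr f : measurable_fun setT f -> measurable_fun setT (r f).
  move=> mf; apply: measurable_funM; first exact: measurableT_comp.
  exact: measurable_indic.
have r0 f x : (0 <= r f x)%R by rewrite mulr_ge0.
have rE (mu : {measure set T -> \bar R}) (f : T -> R) (mf : measurable_fun setT f) :
    \int[mu]_x (g x * `|f x|)%:E = \int[density mu (r f) (mr f mf) (r0 f)]_x (g x)%:E.
  rewrite integral_density//; [|exact/measurable_EFinP].
  apply: eq_integral => x _; rewrite -EFinM /r indicE; congr _%:E.
  have [|] := boolP (x \in D); first by rewrite mulr1.
  by move/negP; rewrite inE => /gD ->; rewrite !mul0r.
rewrite (rE lam n mn) (rE gam w mw) (rE sig v mv).
have mgE : measurable_fun setT (fun x => (g x)%:E) by exact/measurable_EFinP.
have gE0 x : 0 <= (g x)%:E by rewrite lee_fin.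
rewrite -(@ge0_integral_measure_add _ _ _ (density gam (r w) (mr w mw) (r0 w))
  (density sig (r v) (mr v mv) (r0 v)))//.
apply: ge0_le_measure_integral => //.
move=> A mA.
have E (mu : {measure set T -> \bar R}) (f : T -> R) (mf : measurable_fun setT f) :
   density mu (r f) (mr f mf) (r0 f) A = \int[mu]_(x in A `&` D) `|f x|%:E.
  rewrite /density [LHS]integral_mkcond [RHS]integral_mkcond; apply: eq_integral => x _.
  rewrite /patch /r in_setI indicE; case: (x \in A) => //=.
  by case: (x \in D) => /=; rewrite ?mulr1 ?mulr0.
apply: (@le_trans _ _ (\int[lam]_(x in A `&` D) `|n x|%:E)).
  by rewrite -(E lam n mn).
apply: le_trans (abs_domination _ (measurableI _ _ mA mD) (@subIsetr _ _ _)) _.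
rewrite -(E gam w mw) -(E sig v mv) le_eqVlt; apply/orP; left; apply/eqP/esym.
exact: measure_addE.
Qed.

End absolute_domination.

Section borel.
Context {R : realType} {d : nat}.

Lemma continuous_measurable_Rd (f : vec R d -> R) : continuous f ->
  measurable_fun setT (f : Rd R d -> R).
Proof.
move=> cf; apply: (measurability _ (RGenOpens.measurableE R)).
move=> _ [_ [a [b ->] <-]]; rewrite setTI.
apply: sub_sigma_algebra; apply: open_comp; last exact: interval_open.
by move=> x _; exact: cf.
Qed.

Lemma measurable_enorm : measurable_fun setT (@enorm R d : Rd R d -> R).
Proof. by apply: continuous_measurable_Rd; exact: continuous_enorm. Qed.

Lemma BE (r : R) : @B R d r = [set x | enorm x < r].
Proof. by apply/seteqP; split => x; rewrite /B /eball/= subr0. Qed.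

Lemma measurable_B (r : R) : measurable (@B R d r).
Proof.
rewrite BE (_ : [set x | _] = [set: Rd R d] `&` (@enorm R d) @^-1` `]-oo, r[).
  by apply: measurable_enorm.
by rewrite setTI; apply/seteqP; split => x /=; rewrite in_itv.
Qed.

End borel.

Section real_integrands.
Local Open Scope ereal_scope.
Context {d} {T : measurableType d} {R : realType} (mu : {measure set T -> \bar R}).
Implicit Types f g : T -> R.

Lemma ge0_integralZl_real f (k : R) : measurable_fun setT f ->
  (forall x, 0 <= f x)%R -> (0 <= k)%R ->
  \int[mu]_x (k * f x)%:E = k%:E * \int[mu]_x (f x)%:E.
Proof.
move=> mf f0 k0; under eq_integral do rewrite EFinM.
apply: ge0_integralZl => //; first exact/measurable_EFinP.
by move=> x _; rewrite lee_fin.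
Qed.

Lemma ge0_integralD_real f g : measurable_fun setT f -> measurable_fun setT g ->
  (forall x, 0 <= f x)%R -> (forall x, 0 <= g x)%R ->
  \int[mu]_x (f x + g x)%:E = \int[mu]_x (f x)%:E + \int[mu]_x (g x)%:E.
Proof.
move=> mf mg f0 g0; under eq_integral do rewrite EFinD.
by apply: ge0_integralD => //; do ?[exact/measurable_EFinP]; move=> x _; rewrite lee_fin.
Qed.

End real_integrands.

(** * Estimates for one fixed Lebesgue decomposition *)

Section decomposition.
Context {R : realType} {d : nat}.
Variables (p a : R) (gam mu lam : {measure set (Rd R d) -> \bar R})
  (nw w wP : Rd R d -> vec R d) (rho rhoP : Rd R d -> R)
  (sig : {measure set (Rd R d) -> \bar R}).
Hypotheses (p1 : 1 < p) (a0 : 0 <= a) (a1 : a < 1)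
  (dec : lebesgue_dec gam mu lam nw rho w sig rhoP wP).
Local Open Scope ereal_scope.

Let rho0 x : (0 <= rho x)%R. Proof. by case: dec => [[]]. Qed.
Let mrho : measurable_fun setT rho. Proof. by case: dec => [[]]. Qed.
Let rhoP0 x : (0 <= rhoP x)%R. Proof. by case: dec => _ [h _] _ _ _; exact: h. Qed.
Let muE (A : set (Rd R d)) : measurable A ->
  mu A = \int[gam]_(x in A) (rho x)%:E + \int[sig]_(x in A) (rhoP x)%:E.
Proof. by case: dec => _ _ _ h _; exact: h. Qed.

Lemma integral_density_ac_le (g : Rd R d -> R) : measurable_fun setT g ->
  (forall x, 0 <= g x)%R -> \int[gam]_x (g x * rho x)%:E <= \int[mu]_x (g x)%:E.
Proof.
move=> mg g0.
have gE0 x : 0 <= (g x)%:E by rewrite lee_fin.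
have mgE : measurable_fun setT (fun x => (g x)%:E) by exact/measurable_EFinP.
have -> : \int[gam]_x (g x * rho x)%:E = \int[density gam rho mrho rho0]_x (g x)%:E.
  by rewrite integral_density.
apply: ge0_le_measure_integral => // A mA.
rewrite muE// leeDl//; apply: integral_ge0 => x _; by rewrite lee_fin.
Qed.

(** [phi_young] is integrated against gam, and the integral of rho is at most the total mass of mu.
    The singular parts compare for free: the common recession function has values 0 and +oo only, so
    a positive factor does not change it. *)
Lemma dec_value_young (q c : R) : (0 < c)%R -> q = ((1 + a * (p - 1))^-1)%R ->
  mu setT <= 1 ->
  dec_value (p * q) 0 gam rho w sig rhoP wP <=
  (q * c `^ (q - 1))%:E * dec_value p a gam rho w sig rhoP wP + ((1 - q) * c `^ q)%:E.
Proof.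
move=> c0 qE mu1.
have D1 : (1 <= 1 + a * (p - 1))%R by rewrite lerDl mulr_ge0// subr_ge0 ltW.
have D0 : (0 < 1 + a * (p - 1))%R by exact: lt_le_trans D1.
have q0 : (0 < q)%R by rewrite qE invr_gt0.
have q1 : (q <= 1)%R by rewrite qE invf_le1.
have pq1 : (1 < p * q)%R.
  rewrite qE ltr_pdivlMr// mul1r.
  by have : (0 < (1 - a) * (p - 1))%R by [rewrite mulr_gt0// subr_gt0]; lra.
have qc : (0 < q * c `^ (q - 1))%R by rewrite mulr_gt0// powR_gt0.
have recE x : phi_rec (p * q) 0 (rhoP x) (wP x) = phi_rec p a (rhoP x) (wP x).
  by rewrite !phi_recE.
have rec0 x : 0 <= phi_rec p a (rhoP x) (wP x).
  by rewrite phi_recE//; case: ifPn.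
rewrite /dec_value ge0_muleDr; last 2 first.
- by apply: integral_ge0 => x _; apply: phi_ge0.
- by apply: integral_ge0 => x _; exact: rec0.
have H1 : \int[sig]_x phi_rec (p * q) 0 (rhoP x) (wP x) <=
    (q * c `^ (q - 1))%:E * \int[sig]_x phi_rec p a (rhoP x) (wP x).
  rewrite (eq_integral (fun x => phi_rec p a (rhoP x) (wP x))); last by move=> x _.
  rewrite -[leRHS]adde0 -(@integral0 _ _ _ sig setT).
  apply: (le_integral_affine sig setT _ _ (cst 0%R)) => // x _.
  by rewrite adde0 phi_recE//; case: ifPn => _; rewrite ?mule0// gt0_muley ?lte_fin.
have H2 : \int[gam]_x phi (p * q) 0 (rho x) (w x) <=
    (q * c `^ (q - 1))%:E * \int[gam]_x phi p a (rho x) (w x) +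
    \int[gam]_x ((1 - q) * c `^ q * rho x)%:E.
  apply: (le_integral_affine gam setT) => //.
  - by move=> x _; apply: phi_ge0.
  - by move=> x _; apply: phi_ge0.
  - exact: measurable_funM.
  - by move=> x _; rewrite !mulr_ge0 ?powR_ge0 ?subr_ge0.
  - by move=> x _; apply: phi_young.
have H3 : \int[gam]_x ((1 - q) * c `^ q * rho x)%:E <= ((1 - q) * c `^ q)%:E.
  have K0 : (0 <= (1 - q) * c `^ q)%R by rewrite mulr_ge0 ?powR_ge0 ?subr_ge0.
  rewrite ge0_integralZl_real//.
  rewrite -[leRHS]mule1; apply: lee_wpmul2l; first by rewrite lee_fin.
  apply: le_trans mu1; rewrite muE// leeDl//.
  by apply: integral_ge0 => x _; rewrite lee_fin.
apply: le_trans (leeD H2 H1) _; rewrite addeAC leeD2l//.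
Qed.

(* [d.+1] rather than [d] keeps the constant positive in dimension 0. *)
Definition flux_constant : R := (d.+1%:R * (expR 1 * 8 / (1 - a * (p - 1) / p) ^+ 2))%R.

Lemma flux_constant_gt0 : (0 < flux_constant)%R.
Proof.
apply: mulr_gt0 => //; apply: divr_gt0; first by apply: mulr_gt0; rewrite ?expR_gt0.
apply: exprn_gt0; rewrite subr_gt0.
have p0 : (0 < p)%R by exact: lt_trans p1.
rewrite ltr_pdivrMr// mul1r.
have : (0 < (1 - a) * (p - 1))%R by rewrite mulr_gt0// subr_gt0.
lra.
Qed.

(** A coordinatewise majorant of |grad cutoff . nw|, because the comparison of vector measures is
    made on scalar components. *)
Definition flux_majorant (r : R) (x : Rd R d) : R :=
  (\sum_(i < d) `|dcutoff r i x| * `|nw x ord0 i|)%R.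

(** In each coordinate the flux splits into its gam and sig parts. The gam part is bounded by
    [dcutoff_le] followed by [enorm_le_phi], whose middle term integrates to at most l M and whose
    constant term is charged to gam(B_r). *)
Lemma flux_bound (r l kappa M G : R) : (0 < r)%R -> (0 < l)%R ->
  kappa = (p / ((1 - a) * (p - 1)))%R -> vmeasurable nw ->
  \int[mu]_x (cutoff r x)%:E <= M%:E -> gam (@B R d r) <= G%:E ->
  \int[lam]_x (flux_majorant r x)%:E <=
  (flux_constant * l)%:E * dec_value p a gam rho w sig rhoP wP +
  (flux_constant * (l * M + l `^ (1 - kappa) * r `^ (- kappa) * G))%:E.
Proof.
move=> r0 l0 kE mnw hM hG.
have p0 : (0 < p)%R by exact: lt_trans p1.
pose b := (a * (p - 1) / p)%R.
have b0 : (0 <= b)%R by rewrite divr_ge0 ?(ltW p0)// mulr_ge0// subr_ge0 ltW.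
have b1 : (b < 1)%R.
  rewrite ltr_pdivrMr// mul1r.
  by have : (0 < (1 - a) * (p - 1))%R by [rewrite mulr_gt0// subr_gt0]; lra.
pose K := (expR 1 * 8 / (1 - b) ^+ 2)%R.
have K0 : (0 < K)%R.
  apply: divr_gt0; first by apply: mulr_gt0; rewrite ?expR_gt0.
  by apply: exprn_gt0; rewrite subr_gt0.
have mw : vmeasurable w by case: dec => _ _ [[h _] _] _ _; exact: h.
have mwP : vmeasurable wP by case: dec => _ _ [_ [[h _] _]] _ _; exact: h.
have mdc i : measurable_fun setT (dcutoff r i : Rd R d -> R).
  by apply: continuous_measurable_Rd; exact: continuous_dcutoff.
have mc : measurable_fun setT (cutoff r : Rd R d -> R).
  by apply: continuous_measurable_Rd; exact: continuous_cutoff.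
have mindB : measurable_fun setT (\1_(@B R d r) : Rd R d -> R).
  by apply: measurable_indic; exact: measurable_B.
have outB (x : Rd R d) : ~ B r x -> (r <= enorm x)%R.
  by rewrite BE /= => /negP; rewrite -leNgt.
pose E := dec_value p a gam rho w sig rhoP wP.
pose Z := (l `^ (1 - kappa) * r `^ (- kappa))%R.
have Z0 : (0 <= Z)%R by rewrite mulr_ge0// powR_ge0.
have G0 : (0 <= G)%R by rewrite -lee_fin; apply: le_trans hG.
have M0 : (0 <= M)%R.
  rewrite -lee_fin; apply: le_trans hM; apply: integral_ge0 => x _.
  by rewrite lee_fin cutoff_ge0.
have k0 x : (0 <= K * (l * (cutoff r x * rho x) + Z * \1_(B r) x))%R.
  apply: mulr_ge0; first exact: ltW.
  apply: addr_ge0; apply: mulr_ge0 => //; first exact: ltW.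
  by apply: mulr_ge0 => //; exact: cutoff_ge0.
have KMG : (0 <= K * (l * M + Z * G))%R.
  apply: mulr_ge0; first exact: ltW.
  by apply: addr_ge0; apply: mulr_ge0 => //; exact: ltW.
have Kl : (0 < K * l)%R by rewrite mulr_gt0.
have rec0 x : 0 <= phi_rec p a (rhoP x) (wP x).
  by rewrite phi_recE//; case: ifPn.
have E0 : 0 <= E.
  by apply: adde_ge0; apply: integral_ge0 => x _ //; exact: phi_ge0.
have coord i : \int[lam]_x (`|dcutoff r i x| * `|nw x ord0 i|)%:E <=
    (K * l)%:E * E + (K * (l * M + Z * G))%:E.
  have h0 : \int[lam]_x (`|dcutoff r i x| * `|nw x ord0 i|)%:E <=
     \int[gam]_x (`|dcutoff r i x| * `|w x ord0 i|)%:E +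
     \int[sig]_x (`|dcutoff r i x| * `|wP x ord0 i|)%:E.
    apply: (weighted_abs_domination lam gam sig (B r)) => //.
    - exact: measurable_B.
    - move=> A mA AB; case: dec => _ _ _ _ /(_ A mA _ i); apply.
      by exists r.
    - exact: measurableT_comp.
    - by move=> x /outB ?; rewrite dcutoff_eq0// normr0.
  (* The singular flux costs nothing extra: where [wP] is nonzero the recession function is already
     +oo. *)
  have h1 : \int[sig]_x (`|dcutoff r i x| * `|wP x ord0 i|)%:E <=
     (K * l)%:E * \int[sig]_x phi_rec p a (rhoP x) (wP x).
    rewrite -[leRHS]adde0 -(@integral0 _ _ _ sig setT).
    apply: (le_integral_affine sig setT _ _ (cst 0%R)) => // x _.
    rewrite adde0 phi_recE//; case: ifPn => [/eqP w0|_]; last first.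
      by rewrite gt0_muley ?lte_fin// leey.
    have := normr_coord_enorm (wP x) i; rewrite w0 normr_le0 => /eqP ->.
    by rewrite normr0 mulr0 mule0.
  have h2 : \int[gam]_x (`|dcutoff r i x| * `|w x ord0 i|)%:E <=
     (K * l)%:E * \int[gam]_x phi p a (rho x) (w x) +
     \int[gam]_x (K * (l * (cutoff r x * rho x) + Z * \1_(B r) x))%:E.
    apply: (le_integral_affine gam setT) => //.
    - by move=> x _; exact: phi_ge0.
    - apply: measurable_funM => //; apply: measurable_funD.
        by apply: measurable_funM => //; exact: measurable_funM.
      exact: measurable_funM.
    move=> x _.
    have [Bx|nBx] := pselect (B r x); last first.
      rewrite (dcutoff_eq0 _ _ _ r0 (outB _ nBx)) normr0 mul0r.
      apply: adde_ge0; last by rewrite lee_fin.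
      apply: mule_ge0; [by rewrite lee_fin ltW|exact: phi_ge0].
    have H := enorm_le_phi p a (rho x) (w x) (cutoff r x) r l kappa b p1 a0 a1
      (rho0 x) (cutoff_ge0 r x) r0 l0 kE erefl.
    apply: (@le_trans _ _ (K%:E * (r^-1 * cutoff r x `^ b * enorm (w x))%:E)).
      rewrite -EFinM lee_fin.
      rewrite (mulrA K); apply: ler_pM => //; last exact: normr_coord_enorm.
      exact: dcutoff_le.
    apply: le_trans (lee_wpmul2l _ H) _; first by rewrite lee_fin ltW.
    rewrite ge0_muleDr; last 2 first.
      by apply: mule_ge0; [rewrite lee_fin ltW|exact: phi_ge0].
      rewrite lee_fin; apply: addr_ge0 => //; apply: mulr_ge0 => //.
      by apply: mulr_ge0; [exact: ltW|exact: cutoff_ge0].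
    rewrite muleA -EFinM leeD2l// -EFinM lee_fin indicE mem_set// mulr1.
    by rewrite mulrA.
  have h3 : \int[gam]_x (K * (l * (cutoff r x * rho x) + Z * \1_(B r) x))%:E <=
      (K * (l * M + Z * G))%:E.
    have m1 : measurable_fun setT (fun x : Rd R d => (cutoff r x * rho x)%R).
      exact: measurable_funM.
    have c1 x : (0 <= cutoff r x * rho x)%R by rewrite mulr_ge0// cutoff_ge0.
    have m2 : measurable_fun setT (fun x : Rd R d => (l * (cutoff r x * rho x))%R).
      exact: measurable_funM.
    have m3 : measurable_fun setT (fun x : Rd R d => (Z * \1_(B r) x)%R).
      exact: measurable_funM.
    have c2 x : (0 <= l * (cutoff r x * rho x))%R by rewrite mulr_ge0// ltW.
    have c3 (x : Rd R d) : (0 <= Z * \1_(B r) x)%R by rewrite mulr_ge0.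
    rewrite ge0_integralZl_real; last 3 first.
    - exact: measurable_funD.
    - by move=> x; rewrite addr_ge0.
    - exact: ltW.
    rewrite [leRHS]EFinM lee_pmul2l ?lte_fin//.
    rewrite ge0_integralD_real// EFinD; apply: leeD.
      rewrite ge0_integralZl_real// ?(ltW l0)//.
      rewrite [leRHS]EFinM lee_pmul2l ?lte_fin//.
      apply: le_trans hM; apply: integral_density_ac_le => // x; exact: cutoff_ge0.
    rewrite ge0_integralZl_real//.
    rewrite [leRHS]EFinM; apply: (@lee_wpmul2l _ Z%:E); first by rewrite lee_fin.
    by rewrite integral_indic//; [rewrite setIT|exact: measurable_B].
  apply: le_trans h0 _; apply: le_trans (leeD h2 h1) _.
  have -> : (K * l)%:E * E = (K * l)%:E * \int[gam]_x phi p a (rho x) (w x) +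
      (K * l)%:E * \int[sig]_x phi_rec p a (rhoP x) (wP x).
    rewrite /E /dec_value ge0_muleDr//; apply: integral_ge0 => x _ //.
    exact: phi_ge0.
  by rewrite addeAC leeD2l.
rewrite /flux_majorant; under eq_integral do rewrite -sumEFin.
rewrite ge0_integral_sum//; last first.
  move=> i; apply/measurable_EFinP; apply: measurable_funM.
    exact: measurableT_comp.
  by have mi := mnw i; exact: (measurableT_comp _ mi).
apply: (@le_trans _ _ (\sum_(i < d) ((K * l)%:E * E + (K * (l * M + Z * G))%:E))).
  by apply: lee_sum => i _; exact: coord.
have V0 : 0 <= (K * l)%:E * E + (K * (l * M + Z * G))%:E.
  apply: adde_ge0; first by rewrite mule_ge0// lee_fin ltW.
  by rewrite lee_fin.
have -> : \sum_(i < d) ((K * l)%:E * E + (K * (l * M + Z * G))%:E) =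
    d%:R%:E * ((K * l)%:E * E + (K * (l * M + Z * G))%:E).
  have <- : \sum_(i < d) 1%:E = d%:R%:E :> \bar R.
    by rewrite sumEFin sumr_const card_ord.
  by rewrite ge0_sume_distrl//; under [RHS]eq_bigr do rewrite mul1e.
apply: (@le_trans _ _ (d.+1%:R%:E * ((K * l)%:E * E + (K * (l * M + Z * G))%:E))).
  by apply: lee_wpmul2r => //; rewrite lee_fin ler_nat.
rewrite -/E /flux_constant -/b -/K ge0_muleDr; last 2 first.
- by rewrite mule_ge0// lee_fin ltW.
- by rewrite lee_fin.
by rewrite muleA -!EFinM !mulrA.
Qed.

End decomposition.

(** * Mass growth along the continuity equation *)

Section functional.
Context {R : realType} {d : nat}.
Variables (p a : R) (gam mu lam : {measure set (Rd R d) -> \bar R})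
  (nw : Rd R d -> vec R d).
Hypotheses (p1 : 1 < p) (a0 : 0 <= a) (a1 : a < 1).
Local Open Scope ereal_scope.

Lemma le_affine_ereal_inf (S : set (\bar R)) (x : \bar R) (k b : R) : (0 < k)%R ->
  (forall v, S v -> x <= k%:E * v + b%:E) -> x <= k%:E * ereal_inf S + b%:E.
Proof.
move=> k0 H; rewrite -leeBlDr// -lee_pdivrMl//.
apply: le_ereal_inf_tmp => v Sv; rewrite lee_pdivrMl// leeBlDr//; exact: H.
Qed.

Lemma Phi_ge0 s b (s1 : (1 < s)%R) (b0 : (0 <= b)%R) (b1 : (b < 1)%R) :
  0 <= Phi s b mu lam nw gam.
Proof.
rewrite /Phi; case: asboolP => // _; apply: le_ereal_inf_tmp => v.
move=> [rho [w [sig [rhoP [wP [dec ->]]]]]].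
have [[rho0 _] [rhoP0 _] _ _ _] := dec.
apply: adde_ge0; apply: integral_ge0 => x _; first exact: phi_ge0.
by rewrite phi_recE//; case: ifPn.
Qed.

(** Reduces a bound by the infimum to each single decomposition; when the support condition fails, k
    > 0 makes the right side +oo. *)
Lemma le_affine_Phi (x : \bar R) (k b : R) : (0 < k)%R ->
  (forall rho w sig rhoP wP, lebesgue_dec gam mu lam nw rho w sig rhoP wP ->
     x <= k%:E * dec_value p a gam rho w sig rhoP wP + b%:E) ->
  x <= k%:E * Phi p a mu lam nw gam + b%:E.
Proof.
move=> k0 H; rewrite /Phi; case: asboolP => _; last first.
  by rewrite gt0_muley ?lte_fin// addye// leey.
apply: le_affine_ereal_inf => // v [rho [w [sig [rhoP [wP [dec ->]]]]]].
exact: H.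
Qed.

(** A Lebesgue decomposition does not depend on the exponents, so each competitor for the right
    infimum is one for the left. *)
Lemma Phi_young (q c : R) : (0 < c)%R -> q = ((1 + a * (p - 1))^-1)%R ->
  mu setT <= 1 ->
  Phi (p * q) 0 mu lam nw gam <=
  (q * c `^ (q - 1))%:E * Phi p a mu lam nw gam + ((1 - q) * c `^ q)%:E.
Proof.
move=> c0 qE mu1.
have q0 : (0 < q)%R by rewrite qE invr_gt0 ltr_pwDl// mulr_ge0// subr_ge0 ltW.
have qc : (0 < q * c `^ (q - 1))%R by rewrite mulr_gt0// powR_gt0.
have [S|nS] := pselect (msupp mu `<=` msupp gam /\ msupp (vtotvar lam nw) `<=` msupp gam); last first.
  by rewrite /Phi !asboolF// gt0_muley ?lte_fin// addye.
apply: le_affine_Phi => // rho w sig rhoP wP dec.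
apply: le_trans (dec_value_young p a gam mu lam nw w wP rho rhoP sig p1 a0 a1 dec q c c0 qE mu1).
rewrite /Phi asboolT//; apply: ge_ereal_inf; exists (dec_value (p * q) 0 gam rho w sig rhoP wP) => //.
by exists rho, w, sig, rhoP, wP.
Qed.

Lemma Phi_flux (r l kappa M G : R) : (0 < r)%R -> (0 < l)%R ->
  kappa = (p / ((1 - a) * (p - 1)))%R -> vmeasurable nw ->
  \int[mu]_x (cutoff r x)%:E <= M%:E -> gam (@B R d r) <= G%:E ->
  \int[lam]_x (flux_majorant nw r x)%:E <=
  (@flux_constant R d p a * l)%:E * Phi p a mu lam nw gam +
  (@flux_constant R d p a * (l * M + l `^ (1 - kappa) * r `^ (- kappa) * G))%:E.
Proof.
move=> r0 l0 kE mnw hM hG; apply: le_affine_Phi.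
  by rewrite mulr_gt0// flux_constant_gt0.
move=> rho w sig rhoP wP dec.
exact: (flux_bound p a gam mu lam nw w wP rho rhoP sig p1 a0 a1 dec).
Qed.

End functional.

(** * Mass against the cutoff *)

Section cutoff_mass.
Local Open Scope ereal_scope.
Context {R : realType} {d : nat}.
Implicit Types (mu : {measure set (Rd R d) -> \bar R}) (r : R).

Lemma measurable_cutoff r : measurable_fun setT (cutoff r : Rd R d -> R).
Proof. by apply: continuous_measurable_Rd; exact: continuous_cutoff. Qed.

Lemma integrable_cutoff mu r : (0 < r)%R -> locfin mu ->
  mu.-integrable setT (fun x : Rd R d => (cutoff r x)%:E).
Proof.
move=> r0 lmu; apply/integrableP; split.
  by apply/measurable_EFinP; exact: measurable_cutoff.
apply: le_lt_trans (lmu r).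
have mB := @measurable_B R d r.
have -> : mu (B r) = \int[mu]_x (\1_(B r) x)%:E by rewrite integral_indic// setIT.
apply: le_lower_integral => x _ //; rewrite lee_fin ger0_norm ?cutoff_ge0// indicE.
have [xB|] := boolP (x \in _); first exact: cutoff_le1.
move/negP; rewrite inE BE /= => /negP; rewrite -leNgt => rx.
by rewrite cutoff_eq0.
Qed.

Lemma integral_muE mu r : (0 < r)%R -> locfin mu ->
  (integral_mu mu (@cutoff R d r))%:E = \int[mu]_x (cutoff r x)%:E.
Proof.
move=> r0 lmu; rewrite /integral_mu fineK//.
by apply: integrable_fin_num => //; exact: integrable_cutoff.
Qed.

Lemma integral_cutoff_le mu r : \int[mu]_x (cutoff r x)%:E <= mu setT.
Proof.
rewrite -[leRHS]mul1e -integral_cst//; apply: le_lower_integral => x _ /=.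
  by rewrite lee_fin cutoff_ge0.
by rewrite lee_fin cutoff_le1.
Qed.

Lemma cvg_integral_cutoff mu :
  \int[mu]_x (cutoff n.+1%:R x)%:E @[n --> \oo] --> mu setT.
Proof.
have -> : mu setT = \int[mu]_(x in setT) limn (fun n => (@cutoff R d n.+1%:R x)%:E).
  rewrite -[LHS]mul1e -integral_cst//; apply: eq_integral => x _.
  apply/esym/cvg_lim => //; apply: cvg_EFin; last exact: cvg_cutoff.
  exact: nearW.
apply: (@cvg_monotone_convergence _ _ _ mu _ measurableT (fun n (x : Rd R d) => (cutoff n.+1%:R x)%:E)) => //.
- by move=> n; apply/measurable_EFinP; exact: measurable_cutoff.
- by move=> n x _; rewrite lee_fin cutoff_ge0.
- by move=> x _ n m nm; rewrite lee_fin le_cutoff// ler_nat.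
Qed.

Lemma Cc_cutoff r : (0 < r)%R -> Cc (@cutoff R d r).
Proof.
move=> r0; split; first exact: continuous_cutoff.
by exists r => x rx; rewrite cutoff_eq0// ltW.
Qed.

End cutoff_mass.

Lemma leb_I01 {R : realType} : (@leb R (@I01 R) = 1)%E.
Proof. by rewrite /leb /I01 lebesgue_measure_itv/= lte_fin ltr01 oppr0 adde0. Qed.

(** * Testing the continuity equation *)

Section growth.
Local Open Scope ereal_scope.
Context {R : realType} {d : nat}.
Variables (p a : R) (gam mu0 mu1 : {measure set (Rd R d) -> \bar R})
  (mu lam : R -> {measure set (Rd R d) -> \bar R}) (nw : R -> Rd R d -> vec R d).
Hypotheses (p1 : (1 < p)%R) (a0 : (0 <= a)%R) (a1 : (a < 1)%R).
Hypothesis ce : CE mu0 mu1 mu lam nw.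

(** The positive part of f lies below g and the negative part is dropped. It serves for the flux
    against a test function, which changes sign. *)
Lemma le_integral_upper {dd} {T : measurableType dd} (m : {measure set T -> \bar R})
    (D : set T) (f g : T -> \bar R) : (forall x, D x -> 0 <= g x) ->
  (forall x, D x -> f x <= g x) -> \int[m]_(x in D) f x <= \int[m]_(x in D) g x.
Proof.
move=> g0 fg; rewrite integralE.
have h : \int[m]_(x in D) f^\+ x <= \int[m]_(x in D) g x.
  by apply: le_lower_integral => // x Dx; rewrite funeposE ge_max fg// g0.
apply: le_trans h; rewrite -[leRHS]sube0; apply: leeB => //.
by apply: integral_ge0.
Qed.

Let mI01 : measurable (@I01 R). Proof. exact: measurable_itv. Qed.

Let mass r t : R := integral_mu (mu t) (@cutoff R d r).

Let locfin_mu t : I01c t -> locfin (mu t). Proof. by case: ce => -[h _] _ _ _ _; exact: h. Qed.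

Let I01_I01c t : @I01 R t -> @I01c R t.
Proof. by rewrite /I01 /I01c /= !in_itv/= => /andP[/ltW -> /ltW ->]. Qed.

Lemma bump_flux_le r s e k t : (0 < k)%R -> (s + k^-1 <= e)%R -> @I01 R t ->
  \int[lam t]_x (dotv (grad_x (space_time_bump r s e k) x t) (nw t x))%:E <=
  \int[lam t]_x (flux_majorant (nw t) r x)%:E.
Proof.
move=> k0 se tI; apply: le_integral_upper => x _.
  by rewrite lee_fin; apply: sumr_ge0 => i _; rewrite mulr_ge0.
rewrite lee_fin; apply: ler_sum => i _; rewrite grad_space_time_bump.
apply: le_trans (ler_norm _) _; rewrite -mulrA !normrM ler_piMl ?mulr_ge0//.
have /andP[h0 h1] := bump_ge0_le1 s e k t k0 se.
by rewrite ger0_norm.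
Qed.

Lemma integral_dt_bump r s e k t : (0 < r)%R -> I01 t ->
  \int[mu t]_x (dt_fun (space_time_bump r s e k) x t)%:E = (bump' s e k t * mass r t)%:E.
Proof.
move=> r0 tI; have lt := locfin_mu t (I01_I01c t tI).
under eq_integral do rewrite dt_space_time_bump mulrC EFinM.
rewrite integralZl//; last exact: integrable_cutoff.
by rewrite EFinM /mass integral_muE.
Qed.

Lemma continuous_mass r : (0 < r)%R -> {within `[0%R, 1%R], continuous (mass r)}.
Proof.
by move=> r0; case: ce => -[_ h] _ _ _ _; apply: h; exact: Cc_cutoff.
Qed.

(** Testing with cutoff times bump makes the time-derivative term at most mass(0) - mass(t) up to
    eps, and the flux term at most the time integral of [flux_majorant]. The two terms add up to 0,
    so these two upper bounds give the growth estimate. *)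
Lemma mass_growth r l kappa (A M G t : R) : (0 < r)%R -> (0 < l)%R ->
  kappa = (p / ((1 - a) * (p - 1)))%R ->
  action p a gam mu lam nw <= A%:E ->
  (forall t, @I01c R t -> (mass r t <= M)%R) -> gam (@B R d r) <= G%:E ->
  @I01 R t ->
  (mass r t <= mass r 0 + @flux_constant R d p a * (l * A + l * M + l `^ (1 - kappa) * r `^ (- kappa) * G))%R.
Proof.
move=> r0 l0 kE hA hM hG tI.
set C := @flux_constant R d p a.
have C0 : (0 < C)%R by exact: flux_constant_gt0.
set b := (C * (l * M + l `^ (1 - kappa) * r `^ (- kappa) * G))%R.
have mass0 s : @I01c R s -> (0 <= mass r s)%R.
  move=> sI; apply: fine_ge0; apply: integral_ge0 => x _; by rewrite lee_fin cutoff_ge0.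
have M0 : (0 <= M)%R by apply: le_trans (mass0 t _) (hM t _); exact: I01_I01c.
have G0 : (0 <= G)%R by rewrite -lee_fin; apply: le_trans hG.
have b0 : (0 <= b)%R.
  by rewrite /b; apply: mulr_ge0; [exact: ltW|apply: addr_ge0; rewrite !mulr_ge0 ?powR_ge0// ltW].
have Phi0 s : 0 <= Phi p a (mu s) (lam s) (nw s) gam by exact: Phi_ge0.
have total s e k : (0 < s)%R -> (0 < k)%R -> (s + k^-1 <= e)%R -> (e + k^-1 < 1)%R ->
   \int[@leb R]_(t in @I01 R) (\int[lam t]_x (dotv (grad_x (space_time_bump r s e k) x t) (nw t x))%:E)
   <= (C * l * A + b)%:E.
  move=> s0 k0 se ek.
  apply: (@le_trans _ _ (\int[@leb R]_(t in @I01 R) (\int[lam t]_x (flux_majorant (nw t) r x)%:E))).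
    apply: le_integral_upper => u uI; last exact: bump_flux_le.
    by apply: integral_ge0 => x _; rewrite lee_fin; apply: sumr_ge0 => i _; rewrite mulr_ge0.
  apply: (@le_trans _ _ ((C * l)%:E * action p a gam mu lam nw + \int[@leb R]_(t in @I01 R) b%:E)).
    apply: (le_integral_affine (@leb R) (@I01 R) _ _ (cst b)) => //.
    - by rewrite mulr_gt0.
    - by move=> u _; apply: integral_ge0 => x _; rewrite lee_fin; apply: sumr_ge0 => i _; rewrite mulr_ge0.
    - move=> u uI /=; apply: Phi_flux => //.
      + by case: ce => _ _ [/(_ u uI)[_ []]].
      + have ul := locfin_mu u (I01_I01c u uI).
        by rewrite -integral_muE// lee_fin; apply: hM; exact: I01_I01c.
  have -> : \int[@leb R]_(t in @I01 R) b%:E = b%:E.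
    by rewrite integral_cst//; rewrite -[RHS]mule1; congr (_ * _); exact: leb_I01.
  rewrite EFinD leeD2r// [leRHS]EFinM.
  by rewrite lee_pmul2l ?lte_fin ?(mulr_gt0 C0 l0)//.
apply/ler_addgt0Pr => eps eps0; pose ep := (eps / 2)%R.
have ep0 : (0 < ep)%R by rewrite divr_gt0.
have cm := continuous_mass r r0.
have /andP[t0 t1] : (0 < t < 1)%R by move: tI; rewrite /I01/= in_itv.
have [d0 d00 hd0] : exists2 d0, (0 < d0)%R &
    forall s, @I01c R s -> (`|s| < d0)%R -> (mass r s <= mass r 0 + ep)%R.
  have /subspace_continuousP /(_ 0%R) := cm.
  rewrite /= in_itv/= lexx ler01 => /(_ isT) /cvgrPdist_le /(_ _ ep0) [d0/= d00 h].
  exists d0 => // s sI sd; have := h s; rewrite /ball_/= sub0r normrN => /(_ sd sI).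
  by rewrite ler_distlC => /andP[_].
have [d1 d10 hd1] : exists2 d1, (0 < d1)%R &
    forall s, @I01c R s -> (`|t - s| < d1)%R -> (mass r t - ep <= mass r s)%R.
  have /subspace_continuousP /(_ t) := cm.
  move=> /(_ (I01_I01c t tI)) /cvgrPdist_le /(_ _ ep0) [d1/= d10 h].
  exists d1 => // s sI sd; have := h s sd sI.
  by rewrite ler_distlC => /andP[].
(* The test function rises on [dl, 2 dl] and falls on [t, t + dl], where the mass is
   within [ep] of its values at 0 and at [t]. *)
pose dl := (Num.min (Num.min d0 d1) (Num.min t (1 - t)) / 3)%R.
have dl0 : (0 < dl)%R by rewrite divr_gt0// !lt_min d00 d10 t0 subr_gt0 t1.
have [dld0 dld1 dlt dl1t] : [/\ (3 * dl <= d0)%R, (3 * dl <= d1)%R, (3 * dl <= t)%R & (3 * dl <= 1 - t)%R].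
  by rewrite /dl mulrC mulfVK// !ge_min !lexx ?orbT.
pose k := (dl^-1)%R.
have k0 : (0 < k)%R by rewrite invr_gt0.
have kV : (k^-1 = dl)%R by rewrite invrK.
have se : (dl + k^-1 <= t)%R by rewrite kV; lra.
have ek : (t + k^-1 < 1)%R by rewrite kV; lra.
have dlt' : (dl <= t)%R by lra.
have test := space_time_bump_test r dl t k r0 dl0 k0 dlt' ek : test_fun (space_time_bump (d:=d) r dl t k).
case: (ce) => _ _ _ _ /(_ _ test) eq0.
(* On the rise the mass is at most [c], on the fall at least [c']; both replacements increase the
   integral of [bump'] times the mass. *)
pose c := (mass r 0 + ep)%R; pose c' := (mass r t - ep)%R.
have cramp (e : R) : continuous (fun u => ramp' ((u - e) * k) * k)%R.
  move=> u; apply: cvgM; last exact: cvg_cst.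
  apply: (@continuous_comp _ _ _ (fun t : R => (t - e) * k)%R ramp'); last exact: continuous_ramp'.
  by apply: cvgM; [apply: cvgB; [exact: cvg_id|exact: cvg_cst]|exact: cvg_cst].
have int1 : (@leb R).-integrable (@I01 R) (fun u => (bump' dl t k u * mass r u)%:E).
  apply: (@integrableS _ _ _ (@leb R) `[0%R, 1%R]%classic (@I01 R)) => //.
  apply: continuous_compact_integrable; first exact: segment_compact.
  move=> u; apply: cvgM; last exact: cm.
  apply: continuous_subspaceT => {}u; apply: cvgB; exact: cramp.
have int2 : (@leb R).-integrable (@I01 R)
    (fun u => (c * (ramp' ((u - dl) * k) * k) - c' * (ramp' ((u - t) * k) * k))%:E).
  apply: (@integrableS _ _ _ (@leb R) `[0%R, 1%R]%classic (@I01 R)) => //.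
  apply: continuous_compact_integrable; first exact: segment_compact.
  apply: continuous_subspaceT => u; apply: cvgB; apply: cvgM; do ?exact: cvg_cst; exact: cramp.
have le1 : \int[@leb R]_(u in @I01 R) (bump' dl t k u * mass r u)%:E <= (c - c')%:E.
  rewrite -(integral_bump' dl t k c c' dl0 k0 dlt' ek).
  apply: le_integral => // u; rewrite inE => uI.
  have uIc := I01_I01c u uI.
  have /andP[u0 u1] : (0 < u < 1)%R by move: uI; rewrite /I01/= in_itv.
  rewrite lee_fin /bump' mulrBl; apply: lerB.
    rewrite mulrC; have [ud|ud] := (leP ((u - dl) * k) 0)%R.
      by rewrite ramp'_eq0 ?mul0r ?mulr0//; left.
    have [ud2|ud2] := (leP 1 ((u - dl) * k))%R.
      by rewrite ramp'_eq0 ?mul0r ?mulr0//; right.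
    apply: ler_wpM2r; first by rewrite mulr_ge0 ?ramp'_ge0// ltW.
    apply: hd0 => //; rewrite ger0_norm ?(ltW u0)//.
    by move: ud2; rewrite /k ltr_pdivrMr// mul1r => ?; lra.
  rewrite [leRHS]mulrC; have [ud|ud] := (leP ((u - t) * k) 0)%R.
    by rewrite ramp'_eq0 ?mul0r ?mulr0//; left.
  have [ud2|ud2] := (leP 1 ((u - t) * k))%R.
    by rewrite ramp'_eq0 ?mul0r ?mulr0//; right.
  apply: ler_wpM2r; first by rewrite mulr_ge0 ?ramp'_ge0// ltW.
  apply: hd1 => //.
  move: ud2; rewrite /k ltr_pdivrMr// mul1r => ud2.
  move: ud; rewrite pmulr_lgt0// => ud.
  by rewrite distrC gtr0_norm//; lra.
have I1E : \int[@leb R]_(u in @I01 R) (\int[mu u]_x (dt_fun (space_time_bump r dl t k) x u)%:E) =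
   \int[@leb R]_(u in @I01 R) (bump' dl t k u * mass r u)%:E.
  by apply: eq_integral => u; rewrite inE => uI; exact: integral_dt_bump.
rewrite I1E in eq0.
have fin1 : \int[@leb R]_(u in @I01 R) (bump' dl t k u * mass r u)%:E \is a fin_num.
  by apply: integrable_fin_num => //; exact: measurable_itv.
have := total dl t k dl0 k0 se ek.
(* The first integral is finite, so the equation forces the flux integral to be finite too, and the
   rest is real arithmetic. *)
move: eq0 fin1 le1.
case: (\int[@leb R]_(u in _) (bump' _ _ _ _ * _)%:E) => [x|//|//].
case: (\int[@leb R]_(u in _) (\int[lam u]_x _)) => [y|//|//].
rewrite -EFinD => -[] xy _; rewrite !lee_fin /c /c' /ep /b => h1 h2.
by rewrite -mulrA in h2; lra.
Qed.

End growth.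

(** * Conclusion *)

Section mass_bound.
Local Open Scope ereal_scope.
Context {R : realType} {d : nat}.

(** Dominated convergence: on B_r with r >= 1 one has max(1,|x|) <= r, so r^-kappa 1_(B_r) lies
    below the integrand of the moment. Pointwise it is at most 1/r, because kappa >= 1. *)
Lemma cvg_scaled_ball (gam : {measure set (Rd R d) -> \bar R}) (kappa : R) :
  (1 <= kappa)%R -> mtilde (- kappa) gam < +oo ->
  (n.+1%:R `^ (- kappa))%:E * gam (@B R d n.+1%:R) @[n --> \oo] --> 0.
Proof.
move=> k1 mt.
have mB r := @measurable_B R d r.
pose f n (x : Rd R d) := (n.+1%:R `^ (- kappa) * \1_(B n.+1%:R) x)%:E : \bar R.
have fE : (fun n => (n.+1%:R `^ (- kappa))%:E * gam (@B R d n.+1%:R)) =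
    (fun n => \int[gam]_x f n x).
  apply/funext => n; rewrite /f ge0_integralZl_real ?powR_ge0//.
  by rewrite integral_indic// setIT.
rewrite fE -(@integral0 _ _ _ gam setT).
pose g (x : Rd R d) := (Num.max 1 (enorm x) `^ (- kappa))%:E : \bar R.
have mf n : measurable_fun setT (f n).
  by apply/measurable_EFinP; apply: measurable_funM => //; apply: measurable_indic.
have mg : measurable_fun setT g.
  apply/measurable_EFinP; apply: (@measurableT_comp _ _ _ _ _ _ (fun y : R => y `^ (- kappa))%R).
    exact: measurable_powR.
  by apply: measurable_maxr => //; exact: measurable_enorm.
have inv_le n : (n.+1%:R `^ (- kappa) <= n.+1%:R^-1 :> R)%R.
  by rewrite -[leRHS]powR_inv1// ler_powR ?lerN2// ler1n.
have [] // := @dominated_convergence _ _ _ gam setT measurableT f (cst 0) g mf.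
- apply/aeW => x _.
  apply: cvg_EFin; first exact: nearW.
  apply: (@squeeze_cvgr _ _ _ _ (cst 0%R) (fun n => n.+1%:R^-1 : R)%R).
  + apply: nearW => n /=; rewrite mulr_ge0 ?powR_ge0//=.
    apply: le_trans (inv_le n); rewrite ler_piMr ?powR_ge0// indicE.
  + exact: cvg_cst.
  + exact: cvg_harmonic.
- apply/integrableP; split => //.
  apply: le_lt_trans mt; rewrite le_eqVlt; apply/orP; left; apply/eqP.
  by apply: eq_integral => x _; rewrite gee0_abs// lee_fin powR_ge0.
- apply/aeW => x n _; rewrite /f /g lee_fin ger0_norm ?mulr_ge0 ?powR_ge0// indicE.
  have [|] := boolP (x \in _); last by rewrite mulr0 powR_ge0.
  rewrite inE BE/= mulr1 => xn.
  rewrite !powRN lef_pV2 ?posrE ?powR_gt0//; last by rewrite lt_max ltr01.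
  apply: ge0_ler_powR; rewrite ?nnegrE//.
  + exact: le_trans k1.
  + by rewrite le_max ler01.
  + by rewrite ge_max (ltW xn) andbT ler1n.
Qed.

Variables (p a : R) (gam mu0 mu1 : {measure set (Rd R d) -> \bar R})
  (mu lam : R -> {measure set (Rd R d) -> \bar R}) (nw : R -> Rd R d -> vec R d).
Hypotheses (p1 : (1 < p)%R) (a0 : (0 <= a)%R) (a1 : (a < 1)%R).
Hypothesis ce : CE mu0 mu1 mu lam nw.

Let I01P (t : R) : @I01 R t <-> (0 < t < 1)%R.
Proof. by rewrite /I01/= in_itv. Qed.
Let I01cP (t : R) : @I01c R t <-> (0 <= t <= 1)%R.
Proof. by rewrite /I01c/= in_itv. Qed.

Let C := @flux_constant R d p a.
Let C0 : (0 < C)%R. Proof. exact: flux_constant_gt0. Qed.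

Let locfin_mu t : I01c t -> locfin (mu t). Proof. by case: ce => -[h _] _ _ _ _; exact: h. Qed.

(** [mass_growth] is applied at a time where the cutoff mass is maximal, with that maximum as M; the
    term C l M is then absorbed on the left. A maximum at an end point is at most 1 by the
    hypotheses on [mu0] and [mu1]. *)
Lemma mass_cutoff_le r l kappa (A G t : R) : (0 < r)%R -> (0 < l)%R ->
  (C * l < 1)%R -> (0 <= A)%R ->
  kappa = (p / ((1 - a) * (p - 1)))%R ->
  action p a gam mu lam nw <= A%:E -> mu0 setT <= 1 -> mu1 setT <= 1 ->
  gam (@B R d r) <= G%:E -> @I01 R t ->
  (integral_mu (mu t) (@cutoff R d r) <=
   (1 + C * l * A + C * l `^ (1 - kappa) * (r `^ (- kappa) * G)) / (1 - C * l))%R.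
Proof.
move=> r0 l0 Cl A0 kE hA m0 m1 hG tI.
pose m s : R := integral_mu (mu s) (@cutoff R d r).
have G0 : (0 <= G)%R by rewrite -lee_fin; apply: le_trans hG.
have [tm tmI tmax] := EVT_max ler01 (continuous_mass mu0 mu1 mu lam nw ce r r0).
have tmax' s : @I01c R s -> (m s <= m tm)%R by move=> sI; apply: tmax.
have m_end s (mus : {measure set (Rd R d) -> \bar R}) : @I01c R s ->
   (forall A, measurable A -> mu s A = mus A) -> mus setT <= 1 -> (m s <= 1)%R.
  move=> sI E h; have ls := locfin_mu s sI.
  rewrite -lee_fin /m integral_muE//.
  by apply: le_trans (integral_cutoff_le _ _) _; rewrite E.
have I0 : @I01c R 0%R by apply/I01cP; rewrite lexx ler01.
have I1 : @I01c R 1%R by apply/I01cP; rewrite lexx ler01.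
have h0 : (m 0 <= 1)%R.
  by apply: (m_end _ mu0) => //; case: ce => _ [h _] _ _ _; exact: h.
have h1 : (m 1 <= 1)%R.
  by apply: (m_end _ mu1) => //; case: ce => _ [_ h] _ _ _; exact: h.
have /andP[tm0 tm1] : (0 <= tm <= 1)%R by move: tmI; rewrite in_itv.
have M0 : (0 <= m tm)%R.
  by apply: fine_ge0; apply: integral_ge0 => x _; rewrite lee_fin cutoff_ge0.
have rest0 : (0 <= C * (l * A + l * m tm + l `^ (1 - kappa) * r `^ (- kappa) * G))%R.
  apply: mulr_ge0; first exact: ltW.
  by rewrite !addr_ge0// ?mulr_ge0 ?powR_ge0// ltW.
have hM : (m tm <= 1 + C * (l * A + l * m tm + l `^ (1 - kappa) * r `^ (- kappa) * G))%R.
  move: tm0; rewrite le_eqVlt => /predU1P[tm0|tm0].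
    by rewrite -tm0 in rest0 *; apply: le_trans h0 _; rewrite lerDl.
  move: tm1; rewrite le_eqVlt => /predU1P[tm1|tm1].
    by rewrite tm1 in rest0 *; apply: le_trans h1 _; rewrite lerDl.
  have tmI01 : @I01 R tm by apply/I01P; rewrite tm0 tm1.
  have := mass_growth p a gam mu0 mu1 mu lam nw p1 a0 a1 ce r l kappa A (m tm) G tm r0 l0 kE hA tmax' hG tmI01.
  by move/le_trans; apply; rewrite lerD2r.
have tIc : @I01c R t by apply/I01cP; move/I01P: tI => /andP[/ltW -> /ltW ->].
apply: le_trans (tmax' t tIc) _.
rewrite ler_pdivlMr ?subr_gt0// mulrBr mulr1 lerBlDr; apply: le_trans hM _.
rewrite le_eqVlt; apply/orP; left; apply/eqP; ring.
Qed.

Lemma total_mass_le1 kappa (A t : R) : (0 <= A)%R ->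
  kappa = (p / ((1 - a) * (p - 1)))%R ->
  locfin gam -> mtilde (- kappa) gam < +oo ->
  action p a gam mu lam nw <= A%:E -> mu0 setT <= 1 -> mu1 setT <= 1 ->
  @I01 R t -> mu t setT <= 1.
Proof.
move=> A0 kE lgam mt hA m0 m1 tI.
have tIc : @I01c R t by apply/I01cP; move/I01P: tI => /andP[/ltW -> /ltW ->].
have p0 : (0 < p)%R by exact: lt_trans p1.
have D0 : (0 < (1 - a) * (p - 1))%R by rewrite mulr_gt0// subr_gt0.
have k1 : (1 <= kappa)%R.
  rewrite kE ler_pdivlMr// mul1r.
  have : (0 <= a * (p - 1))%R by rewrite mulr_ge0// subr_ge0 ltW.
  lra.
have gfin n : gam (@B R d n.+1%:R) \is a fin_num by rewrite ge0_fin_numE.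
have cG : (n.+1%:R `^ (- kappa) * fine (gam (@B R d n.+1%:R)))%R @[n --> \oo] --> (0%R : R).
  have /fine_cvgP[_ h] := cvg_scaled_ball gam kappa k1 mt.
  apply: cvg_trans h; apply: near_eq_cvg; apply: nearW => n /=.
  by rewrite fineM.
apply/lee_addgt0Pr => e e0.
have Ae : (0 < A + 1 + e)%R by rewrite addr_gt0// ltr_wpDl.
(* This [x] = C l solves (1 + x A) / (1 - x) = 1 + e, so the limit in the radius, taken with l
   fixed, is exactly 1 + e. *)
pose x := (e / (A + 1 + e))%R.
have x0 : (0 < x)%R by rewrite divr_gt0.
have x1 : (x < 1)%R by rewrite ltr_pdivrMr// mul1r; lra.
pose l := (x / C)%R.
have l0 : (0 < l)%R by rewrite divr_gt0.
have Clx : (C * l = x)%R by rewrite /l mulrC mulfVK// gt_eqF.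
have Cl1 : (C * l < 1)%R by rewrite Clx.
have U n : \int[mu t]_y (cutoff n.+1%:R y)%:E <=
   ((1 + C * l * A + C * l `^ (1 - kappa) * (n.+1%:R `^ (- kappa) * fine (gam (@B R d n.+1%:R)))) / (1 - C * l))%:E.
  have lmu := locfin_mu t tIc.
  rewrite -integral_muE// lee_fin; apply: mass_cutoff_le => //.
  by rewrite fineK.
have cU : ((1 + C * l * A + C * l `^ (1 - kappa) * (n.+1%:R `^ (- kappa) * fine (gam (@B R d n.+1%:R)))) / (1 - C * l))%:E
    @[n --> \oo] --> (1 + e)%:E.
  apply: cvg_EFin; first exact: nearW.
  have -> : (1 + e = (1 + C * l * A + C * l `^ (1 - kappa) * 0) / (1 - C * l))%R.
    rewrite mulr0 addr0 Clx; apply: (mulIf (lt0r_neq0 (_ : 0 < 1 - x)%R)); first by rewrite subr_gt0.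
    rewrite mulfVK; last by rewrite gt_eqF// subr_gt0.
    rewrite /x; field; by rewrite gt_eqF.
  apply: cvgM; last exact: cvg_cst.
  apply: cvgD; first exact: cvg_cst.
  apply: cvgM; first exact: cvg_cst.
  exact: cG.
have cm := @cvg_integral_cutoff R d (mu t).
apply: (lee_cvg_to cm cU).
exact: nearW.
Qed.

End mass_bound.

(** * From actions to distances *)

Lemma ge0_le_poweR {R : realType} (x y : \bar R) (r : R) :
  0 <= r -> (0 <= x)%E -> (x <= y)%E -> (x `^ r <= y `^ r)%E.
Proof.
move=> r0 x0 xy; apply: gt0_ler_poweR => //; rewrite in_itv/= leey andbT //; exact: le_trans xy.
Qed.

Lemma poweR_root_le {R : realType} (x y : \bar R) (s q : R) : 0 < s ->
  (x `^ q^-1 <= y)%E -> (x `^ (s * q)^-1 <= y `^ s^-1)%E.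
Proof.
move=> s0 xy; have -> : (s * q)^-1 = q^-1 * s^-1 by rewrite invfM mulrC.
rewrite poweRrM; apply: ge0_le_poweR xy; last exact: poweR_ge0.
by rewrite invr_ge0 ltW.
Qed.

(** The bound is asked for c > A instead of c = A because Young's inequality needs c > 0, while the
    action A may be 0. *)
Lemma root_le_of_le_powR {R : realType} (x : \bar R) (A q : R) :
  0 < q -> 0 <= A -> (0 <= x)%E ->
  (forall c, A < c -> (x <= (c `^ q)%:E)%E) -> (x `^ q^-1 <= A%:E)%E.
Proof.
move=> q0 A0 x0 H; apply/lee_addgt0Pr => e e0.
have c0 : 0 < A + e by rewrite ltr_wpDl.
rewrite -EFinD (_ : A + e = ((A + e) `^ q) `^ q^-1); last first.
  by rewrite -powRrM mulfV ?gt_eqF// powRr1// ltW.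
rewrite -poweR_EFin; apply: ge0_le_poweR => //; first by rewrite invr_ge0 ltW.
by apply: H; rewrite ltrDl.
Qed.

Lemma action_ge0 {R : realType} {d : nat} (s b : R) (gam : {measure set (Rd R d) -> \bar R})
    mu lam nw : 1 < s -> 0 <= b -> b < 1 -> (0 <= action s b gam mu lam nw)%E.
Proof. by move=> s1 b0 b1; apply: integral_ge0 => t _; exact: Phi_ge0. Qed.

(** Both distances are infima over the same curves, and the outer exponents satisfy 1/(s q) =
    (1/q)(1/s); it remains to compare the two actions of one curve of finite action. *)
Lemma Wdist_le {R : realType} {d : nat} (s b b' q : R)
    (gam mu0 mu1 : {measure set (Rd R d) -> \bar R}) :
  1 < s -> 0 <= b -> b < 1 -> 0 < q -> 1 < s * q -> 0 <= b' -> b' < 1 ->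
  (forall mu lam nw A c, CE mu0 mu1 mu lam nw -> 0 <= A ->
     action s b gam mu lam nw = A%:E -> A < c ->
     (action (s * q) b' gam mu lam nw <= (c `^ q)%:E)%E) ->
  (Wdist (s * q) b' gam mu0 mu1 <= Wdist s b gam mu0 mu1)%E.
Proof.
move=> s1 b0 b1 q0 sq1 b'0 b'1 H.
apply: poweR_root_le; first exact: lt_trans s1.
apply: le_ereal_inf_tmp => v [mu [lam [nw [ce ->]]]].
have := action_ge0 s b gam mu lam nw s1 b0 b1.
case E: (action s b gam mu lam nw) => [A| |//] A0; last by rewrite leey.
rewrite lee_fin in A0.
apply: root_le_of_le_powR => //.
  apply: le_ereal_inf_tmp => _ [mu' [lam' [nw' [_ ->]]]].
  exact: action_ge0.
move=> c Ac; apply: ge_ereal_inf; exists (action (s * q) b' gam mu lam nw).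
  by exists mu, lam, nw.
exact: H E Ac.
Qed.

(* p in (1,oo), alpha in [0,1), theta = (1-alpha) p + alpha,
   kappa = p / (theta - 1), kappa* = kappa / (kappa - 1);
   gamma a nonnegative Radon measure on R^d with tilde m_{-kappa}(gamma) < oo;
   mu0, mu1 probability measures on R^d. *)
Theorem mainTheorem15 (R : realType) (d : nat) (p alpha : R)
  (gamma : {measure set (Rd R d) -> \bar R})
  (mu0 mu1 : probability (Rd R d) R) :
  1 < p -> 0 <= alpha -> alpha < 1 ->
  locfin gamma ->
  let th := theta p alpha in
  let kappa := p / (th - 1) in
  let kappa_star := kappa / (kappa - 1) in
  (mtilde (- kappa) gamma < +oo)%E ->
  (Wdist kappa_star 0 gamma mu0 mu1 <= Wdist p alpha gamma mu0 mu1)%E.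
Proof.
move=> p1 a0 a1 lgam th kappa kappa_star mt.
have p0 : 0 < p by exact: lt_trans p1.
have D0 : 0 < (1 - alpha) * (p - 1) by rewrite mulr_gt0// subr_gt0.
have thE : th - 1 = (1 - alpha) * (p - 1) by rewrite /th /theta; ring.
have kE : kappa = p / ((1 - alpha) * (p - 1)) by rewrite /kappa thE.
have E1 : 1 <= 1 + alpha * (p - 1) by rewrite lerDl mulr_ge0// subr_ge0 ltW.
have E0 : 0 < 1 + alpha * (p - 1) by exact: lt_le_trans E1.
pose q := (1 + alpha * (p - 1))^-1.
have q0 : 0 < q by rewrite invr_gt0.
have q1 : q <= 1 by rewrite invf_le1.
have ksE : kappa_star = p * q.
  rewrite /kappa_star /q kE.
  have -> : p / ((1 - alpha) * (p - 1)) - 1 = (1 + alpha * (p - 1)) / ((1 - alpha) * (p - 1)).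
    have pn : p - 1 != 0 by rewrite gt_eqF// subr_gt0.
    have an : 1 - alpha != 0 by rewrite gt_eqF// subr_gt0.
    by field; rewrite ?pn ?an.
  by rewrite invf_div mulrA mulfVK// gt_eqF.
have ks1 : 1 < p * q.
  by rewrite /q ltr_pdivlMr// mul1r; lra.
rewrite ksE; apply: Wdist_le => // mu lam nw A c ce A0 E Ac.
have c0 : 0 < c by exact: le_lt_trans Ac.
have mass1 t : @I01 R t -> (mu t setT <= 1)%E.
  move=> tI; apply: (total_mass_le1 p alpha gamma mu0 mu1 mu lam nw p1 a0 a1 ce kappa A) => //.
  - by rewrite E.
  - exact: probability_le1.
  - exact: probability_le1.
have qc : 0 < q * c `^ (q - 1) by rewrite mulr_gt0// powR_gt0.
apply: (@le_trans _ _ ((q * c `^ (q - 1))%:E * action p alpha gamma mu lam nw +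
  \int[@leb R]_(t in @I01 R) ((1 - q) * c `^ q)%:E)%E).
  apply: (le_integral_affine (@leb R) (@I01 R) _ _ (cst ((1 - q) * c `^ q))) => //.
  - exact: measurable_itv.
  - by move=> t _; exact: Phi_ge0.
  - by move=> t _; exact: Phi_ge0.
  - by move=> t _ /=; rewrite mulr_ge0 ?powR_ge0// subr_ge0.
  - by move=> t tI; apply: Phi_young => //; exact: mass1.
have -> : (\int[@leb R]_(t in @I01 R) ((1 - q) * c `^ q)%:E = ((1 - q) * c `^ q)%:E)%E.
  rewrite integral_cst; last exact: measurable_itv.
  by rewrite -[RHS]mule1; congr (_ * _)%E; exact: leb_I01.
rewrite E -EFinM -EFinD lee_fin.
(* Since c^(q-1) c = c^q, the right side is the Young bound with A replaced by c, and A < c. *)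
rewrite [leRHS](_ : _ = q * c `^ (q - 1) * c + (1 - q) * c `^ q); last first.
  by rewrite -mulrA (mulrC _ c) mulr_powRB1 ?(ltW c0)//; ring.
by rewrite lerD2r ler_pM2l// ltW.
Qed.
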